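(* Let $\mathcal M=(M,d,(q_i))$ be a computable metric space and $x\in M$. Then $x$ has a $K$-trivial Cauchy name if and only if $x$ is locally $K$-trivial, i.e. there is $b\in\mathbb N$ such that for every $n$ there is a special point $p$ with $d(x,p)<2^{-n}$ and $K(p,n)\le K(n)+b$. Moreover, if $x$ is locally $K$-trivial via $b$ then $x$ has a Cauchy name that is $K$-trivial via a constant $b+O(1)$.
   Context: A computable metric space is a complete separable metric space with a dense sequence $(q_i)$ of special points (identified with $i\in\mathbb N$) such that $d(q_i,q_k)$ is computable uniformly in $i,k$. A Cauchy name is $\alpha:\mathbb N\to\mathbb N$ with $d(q_{\alpha(s)},q_{\alpha(t)})\le2^{-s}$ for $t\ge s$, naming $\lim_s q_{\alpha(s)}$. $K$ is prefix-free Kolmogorov complexity; $K(p,n)$ is the complexity of the pair $\langle p,n\rangle$. A function $\alpha:\mathbb N\to\mathbb N$ is $K$-trivial via $b$ if $K(\alpha\upharpoonright n)\le K(0^n)+b$ for all $n$ (tuples encoded effectively as strings). *)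

(* Defs.v *)
From Stdlib Require Import Reals List Arith ClassicalEpsilon.
Import ListNotations.
Open Scope R_scope.

Inductive prf : Type :=
| PZero : prf
| PSucc : prf
| PProj : nat -> prf
| PComp : prf -> list prf -> prf
| PRec  : prf -> prf -> prf
| PMu   : prf -> prf.

Inductive eval : prf -> list nat -> nat -> Prop :=
| ev_zero xs : eval PZero xs 0
| ev_succ x xs : eval PSucc (x :: xs) (S x)
| ev_proj i xs y : nth_error xs i = Some y -> eval (PProj i) xs y
| ev_comp f gs xs ys y : evals gs xs ys -> eval f ys y -> eval (PComp f gs) xs y
| ev_rec0 f g xs y : eval f xs y -> eval (PRec f g) (0%nat :: xs) y
| ev_recS f g n xs z y :
    eval (PRec f g) (n :: xs) z -> eval g (n :: z :: xs) y ->
    eval (PRec f g) (S n :: xs) y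
| ev_mu f xs n :
    eval f (n :: xs) 0%nat ->
    (forall m, (m < n)%nat -> exists k, eval f (m :: xs) (S k)) ->
    eval (PMu f) xs n
with evals : list prf -> list nat -> list nat -> Prop :=
| evs_nil xs : evals nil xs nil
| evs_cons g gs xs y ys : eval g xs y -> evals gs xs ys -> evals (g :: gs) xs (y :: ys).

Definition pairN (i n : nat) : nat := ((i + n) * S (i + n)) / 2 + n.

(* Bijective coding of binary strings by naturals. *)
Fixpoint code_bits (s : list bool) : nat :=
  match s with
  | nil => 0
  | b :: s' => S (2 * code_bits s' + (if b then 1 else 0))
  end.

(* Bijective coding of finite tuples of naturals. *)
Fixpoint code_list (l : list nat) : nat :=
  match l with
  | nil => 0
  | x :: l' => S (pairN x (code_list l'))
  end.

Definition runs (e : prf) (s : list bool) (y : nat) : Prop := eval e [code_bits s] y.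

Definition halts (e : prf) (s : list bool) : Prop := exists y, runs e s y.

Definition is_prefix (s t : list bool) : Prop := exists u, s ++ u = t.

Definition prefix_free_machine (e : prf) : Prop :=
  forall s t, halts e s -> halts e t -> is_prefix s t -> s = t.

Definition optimal_pf_machine (U : prf) : Prop :=
  prefix_free_machine U /\
  forall N, prefix_free_machine N ->
    exists c : nat, forall s y, runs N s y ->
      exists t, runs U t y /\ (length t <= length s + c)%nat.

Definition Kc (U : prf) (y : nat) : nat :=
  epsilon (inhabits 0%nat)
    (fun k => (exists s, runs U s y /\ length s = k) /\
              (forall s, runs U s y -> (k <= length s)%nat)).

Record CMS : Type := {
  carrier :> Type;
  dist : carrier -> carrier -> R;
  dist_nonneg : forall x y, 0 <= dist x y;
  dist_eq0 : forall x y, dist x y = 0 <-> x = y;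
  dist_sym : forall x y, dist x y = dist y x;
  dist_tri : forall x y z, dist x z <= dist x y + dist y z;
  complete : forall u : nat -> carrier,
      (forall eps, 0 < eps -> exists N, forall m n, (N <= m)%nat -> (N <= n)%nat ->
           dist (u m) (u n) < eps) ->
      exists l, forall eps, 0 < eps -> exists N, forall n, (N <= n)%nat -> dist (u n) l < eps;
  special : nat -> carrier;
  special_dense : forall x eps, 0 < eps -> exists i, dist x (special i) < eps;
  dist_computable : exists e : prf, forall i k n, exists m,
      eval e [i; k; n] m /\
      Rabs (dist (special i) (special k) - INR m / 2 ^ n) <= / 2 ^ n
}.

Definition cauchy_name (M : CMS) (alpha : nat -> nat) (x : M) : Prop :=
  (forall s t, (s <= t)%nat ->
     dist M (special M (alpha s)) (special M (alpha t)) <= / 2 ^ s) /\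
  (forall eps, 0 < eps -> exists N, forall s, (N <= s)%nat ->
     dist M (special M (alpha s)) x < eps).

Definition K_trivial_via (U : prf) (alpha : nat -> nat) (b : nat) : Prop :=
  forall n, (Kc U (code_list (map alpha (seq 0 n)))
             <= Kc U (code_list (repeat 0%nat n)) + b)%nat.

Definition locally_K_trivial_via (U : prf) (M : CMS) (x : M) (b : nat) : Prop :=
  forall n, exists p, dist M x (special M p) < / 2 ^ n /\
    (Kc U (pairN p n) <= Kc U n + b)%nat.

(* Main.v *)
From Stdlib Require Import Reals List Arith Lia Lra ClassicalEpsilon.
Require Import Defs.
Import ListNotations.
Local Open Scope nat_scope.

(** From a K-trivial name [alpha], the point [alpha (n + 1)] is within [2^-n] of [x] and is read off the first [n + 2] values of [alpha], so it witnesses local K-triviality at [n].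

Conversely, the obstacle is that the approximation of [K(n)] may drop after the construction has committed itself at length [n]. It is avoided by replacing [n] with the level [s = <y, <w, t>>], where [w] is a description of [y = 0^n] and [t] its running time: [s] is computable from [w], so [x] has a [2^-(s+5)]-approximation [p] with [K(p, s + 5) <= |w| + b + O(1)], and the number [|w|] is known exactly from [s]. A machine reads descriptions [w'] of pairs [<p, s + 5>], padded to length [|w| + B] so that [B] is known as well. It waits until a tuple with the same [B] and a nearby last point has been served at the preceding level, and then extends this tuple by copies of [p]. Only finitely many tuples with parameter [B] are served at each level, and served tuples have served prefixes at all lower levels, so Konig's lemma, applied to the tuples whose last point is a correct approximation, gives a name [alpha] whose initial segments are all served: [K(alpha|n) <= |w| + B + O(1)], with [|w| = K(0^n)] when [w] is shortest. *)

(** The generated principle gives no hypothesis for the programs in the list of [PComp]; the inner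
    [fix] supplies it as a [Forall]. *)
Definition prf_nested_ind (P : prf -> Prop)
  (H0 : P PZero) (HS : P PSucc) (Hp : forall i, P (PProj i))
  (Hc : forall f gs, P f -> Forall P gs -> P (PComp f gs))
  (Hr : forall f g, P f -> P g -> P (PRec f g))
  (Hm : forall f, P f -> P (PMu f)) : forall e, P e :=
  fix IH e : P e :=
    match e with
    | PZero => H0
    | PSucc => HS
    | PProj i => Hp i
    | PComp f gs =>
        Hc f gs (IH f)
          ((fix IHs l : Forall P l :=
              match l with
              | nil => Forall_nil P
              | g :: l' => Forall_cons g (IH g) (IHs l')
              end) gs)
    | PRec f g => Hr f g (IH f) (IH g)
    | PMu f => Hm f (IH f)
    end.

(** Loops are written with this iterator because it mirrors [PRec]; their computability then reduces
    to closure under [nrec]. *)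
Fixpoint nrec {B : Type} (b : B) (f : nat -> B -> B) (n : nat) : B :=
  match n with
  | 0 => b
  | S k => f k (nrec b f k)
  end.

(** * Bounded evaluation *)

(* State of the search of [PMu] below a bound: 0 while searching, 1 if some value diverged, [S (S m)] once the zero [m] is found. *)
Definition mu_step (r : nat -> option nat) (m st : nat) : nat :=
  match st with
  | 0 => match r m with
         | Some v => match v with 0 => S (S m) | S _ => 0 end
         | None => 1
         end
  | S _ => st
  end.

(** The fuel [t] bounds only the search of [PMu]; every other clause terminates by itself. The local
    fixpoint satisfies the guard condition, and [run_list] is its named copy. *)
Fixpoint run (e : prf) (t : nat) (xs : list nat) : option nat :=
  match e with
  | PZero => Some 0
  | PSucc => match xs with nil => None | x :: _ => Some (S x) end
  | PProj i => nth_error xs i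
  | PComp f gs =>
      match (fix runs_list l : option (list nat) :=
               match l with
               | nil => Some nil
               | g :: l' =>
                   match run g t xs with
                   | Some y => match runs_list l' with
                               | Some ys => Some (y :: ys)
                               | None => None
                               end
                   | None => None
                   end
               end) gs with
      | Some ys => run f t ys
      | None => None
      end
  | PRec f g =>
      match xs with
      | nil => None
      | n :: xs' =>
          nrec (run f t xs')
            (fun m o => match o with
                        | Some z => run g t (m :: z :: xs')
                        | None => None
                        end) n
      end
  | PMu f =>
      match nrec 0 (mu_step (fun m => run f t (m :: xs))) t with
      | 0 => None
      | S k => match k with 0 => None | S m => Some m end
      end
  end.

Fixpoint run_list (gs : list prf) (t : nat) (xs : list nat) : option (list nat) :=
  match gs with
  | nil => Some nil
  | g :: l' =>
      match run g t xs with
      | Some y => match run_list l' t xs with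
                  | Some ys => Some (y :: ys)
                  | None => None
                  end
      | None => None
      end
  end.

Lemma run_comp f gs t xs :
  run (PComp f gs) t xs =
  match run_list gs t xs with Some ys => run f t ys | None => None end.
Proof.
  simpl.
  match goal with |- match ?F gs with _ => _ end = _ => set (G := F) end.
  replace (G gs) with (run_list gs t xs); [reflexivity|].
  induction gs as [|g gs IH]; [reflexivity|].
  simpl. now rewrite IH.
Qed.

Lemma mu_step_found r t m :
  nrec 0 (mu_step r) t = S (S m) <->
  m < t /\ r m = Some 0 /\ (forall k, k < m -> exists v, r k = Some (S v)).
Proof.
  (* A found state arises from state 0 at the last step or is inherited, so state 0 has to be
     characterised first. *)
  assert (H0 : forall t, nrec 0 (mu_step r) t = 0 <->
            (forall k, k < t -> exists v, r k = Some (S v))).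
  { induction t0 as [|t0 IH]; simpl.
    - split; [intros _ k Hk; lia | reflexivity].
    - split.
      + intros H.
        destruct (nrec 0 (mu_step r) t0) eqn:E; simpl in H; [|discriminate].
        destruct (r t0) as [[|v]|] eqn:Er; try discriminate.
        intros k Hk. destruct (Nat.eq_dec k t0) as [->|Hne]; [eauto|].
        apply (proj1 IH eq_refl). lia.
      + intros H.
        rewrite (proj2 IH) by (intros k Hk; apply H; lia).
        destruct (H t0) as [v Hv]; [lia|]. simpl. now rewrite Hv. }
  induction t as [|t IH]; simpl.
  - split; [discriminate | lia].
  - split.
    + intros H.
      destruct (nrec 0 (mu_step r) t) as [|q] eqn:E; simpl in H.
      * destruct (r t) as [[|v]|] eqn:Er; try discriminate.
        injection H as <-. repeat split; auto.
        apply H0, E.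
      * destruct (proj1 IH H) as (H1 & H2 & H3). auto.
    + intros (H1 & H2 & H3).
      destruct (Nat.eq_dec m t) as [->|Hne].
      * rewrite (proj2 (H0 t) H3). simpl. now rewrite H2.
      * rewrite (proj2 IH) by (repeat split; auto; lia). reflexivity.
Qed.

Lemma run_mu_spec f t xs y :
  run (PMu f) t xs = Some y <->
  y < t /\ run f t (y :: xs) = Some 0 /\
  (forall k, k < y -> exists v, run f t (k :: xs) = Some (S v)).
Proof.
  rewrite <- (mu_step_found (fun m => run f t (m :: xs))). simpl.
  destruct (nrec 0 _ t) as [|[|m]]; split; congruence.
Qed.

Lemma run_mono e : forall t t' xs y, t <= t' -> run e t xs = Some y -> run e t' xs = Some y.
Proof.
  induction e as [| |i|f gs IHf IHgs|f g IHf IHg|f IHf] using prf_nested_ind;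
    intros t t' xs y Ht.
  - auto.
  - auto.
  - auto.
  - rewrite !run_comp.
    destruct (run_list gs t xs) as [ys|] eqn:E; [|discriminate].
    assert (E' : run_list gs t' xs = Some ys).
    { revert ys E. induction IHgs as [|g gs Hg _ IH]; simpl; [auto|].
      intros ys.
      destruct (run g t xs) eqn:E1; [|discriminate].
      rewrite (Hg _ _ _ _ Ht E1).
      destruct (run_list gs t xs) eqn:E2; [|discriminate].
      now rewrite (IH _ eq_refl). }
    rewrite E'. eauto.
  - destruct xs as [|n xs]; [discriminate|]. simpl.
    revert y. induction n as [|n IH]; simpl; intros y; [eauto|].
    destruct (nrec (run f t xs) _ n) as [z|]; [|discriminate].
    rewrite (IH _ eq_refl). eauto.
  - rewrite !run_mu_spec. intros (H1 & H2 & H3). repeat split; [lia|eauto|].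
    intros k Hk. destruct (H3 k Hk) as [v Hv]. eauto.
Qed.

Lemma run_list_mono gs : forall t t' xs ys,
  t <= t' -> run_list gs t xs = Some ys -> run_list gs t' xs = Some ys.
Proof.
  induction gs as [|g gs IH]; simpl; [auto|].
  intros t t' xs ys Ht.
  destruct (run g t xs) eqn:E1; [|discriminate].
  rewrite (run_mono _ _ _ _ _ Ht E1).
  destruct (run_list gs t xs) eqn:E2; [|discriminate].
  now rewrite (IH _ _ _ _ Ht E2).
Qed.

Lemma run_sound e : forall t xs y, run e t xs = Some y -> eval e xs y.
Proof.
  induction e as [| |i|f gs IHf IHgs|f g IHf IHg|f IHf] using prf_nested_ind;
    intros t xs y.
  - intros [= <-]. constructor.
  - destruct xs; intros [= <-]. constructor.
  - intros H. now constructor.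
  - rewrite run_comp.
    destruct (run_list gs t xs) as [ys|] eqn:E; [|discriminate].
    intros H. apply ev_comp with ys; [|eauto].
    clear H. revert ys E.
    induction IHgs as [|g gs Hg _ IH]; simpl; intros ys.
    + intros [= <-]. constructor.
    + destruct (run g t xs) eqn:E1; [|discriminate].
      destruct (run_list gs t xs) eqn:E2; [|discriminate].
      intros [= <-]. constructor; eauto.
  - destruct xs as [|n xs]; [discriminate|]. simpl.
    revert y. induction n as [|n IH]; simpl; intros y H.
    + constructor. eauto.
    + destruct (nrec (run f t xs) _ n) as [z|]; [|discriminate].
      apply ev_recS with z; eauto.
  - rewrite run_mu_spec. intros (H1 & H2 & H3). constructor; [eauto|].
    intros m Hm. destruct (H3 m Hm) as [v Hv]. eauto.
Qed.

(** An induction principle gives no hypothesis for the derivations under the existential of [ev_mu],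
    hence the explicit mutual recursion on derivations. *)
Fixpoint run_complete e xs y (H : eval e xs y) {struct H} : exists t, run e t xs = Some y
with run_list_complete gs xs ys (H : evals gs xs ys) {struct H} :
  exists t, run_list gs t xs = Some ys.
Proof.
  - destruct H as [xs|x xs|i xs y Hn|f gs xs ys y Hgs Hf|f g xs y Hf
                  |f g n xs z y Hz Hg|f xs n H0 Hex].
    + now exists 0.
    + now exists 0.
    + now exists 0.
    + destruct (run_list_complete _ _ _ Hgs) as [t1 H1].
      destruct (run_complete _ _ _ Hf) as [t2 H2].
      exists (max t1 t2). rewrite run_comp.
      rewrite (run_list_mono _ t1 (max t1 t2) _ _ ltac:(lia) H1).
      apply run_mono with t2; [lia|auto].
    + destruct (run_complete _ _ _ Hf) as [t H1]. exists t. exact H1.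
    + destruct (run_complete _ _ _ Hz) as [t1 H1].
      destruct (run_complete _ _ _ Hg) as [t2 H2].
      exists (max t1 t2).
      apply (run_mono _ _ (max t1 t2)) in H1; [|lia].
      apply (run_mono _ _ (max t1 t2)) in H2; [|lia].
      simpl in *. now rewrite H1.
    + destruct (run_complete _ _ _ H0) as [t1 H1].
      assert (IH : forall m, m < n -> exists v t, run f t (m :: xs) = Some (S v)).
      { intros m Hm. destruct (Hex m Hm) as [v Hv].
        exists v. exact (run_complete _ _ _ Hv). }
      clear Hex H0 run_complete run_list_complete.
      (* Only finitely many fuels occur below the zero [n], so they have a common bound. *)
      assert (HB : forall j, j <= n -> exists T, forall k, k < j ->
                 exists v, run f T (k :: xs) = Some (S v)).
      { induction j as [|j IHj]; intros Hj.
        - exists 0. lia.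
        - destruct IHj as [T HT]; [lia|].
          destruct (IH j Hj) as (v & t & Ht).
          exists (max T t). intros k Hk.
          destruct (Nat.eq_dec k j) as [->|Hne].
          + exists v. apply run_mono with t; [lia|exact Ht].
          + destruct (HT k) as [v' Hv']; [lia|].
            exists v'. apply run_mono with T; [lia|exact Hv']. }
      destruct (HB n (le_n n)) as [T HT].
      exists (S (max n (max t1 T))). apply run_mu_spec. repeat split; [lia| |].
      * apply run_mono with t1; [lia|exact H1].
      * intros k Hk. destruct (HT k Hk) as [v Hv]. exists v.
        apply run_mono with T; [lia|exact Hv].
  - destruct H as [xs|g gs xs y ys Hg Hgs].
    + now exists 0.
    + destruct (run_complete _ _ _ Hg) as [t1 H1].
      destruct (run_list_complete _ _ _ Hgs) as [t2 H2].
      exists (max t1 t2). simpl.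
      rewrite (run_mono _ t1 (max t1 t2) _ _ ltac:(lia) H1).
      now rewrite (run_list_mono _ t2 (max t1 t2) _ _ ltac:(lia) H2).
Qed.

Lemma eval_det e xs y y' : eval e xs y -> eval e xs y' -> y = y'.
Proof.
  intros H H'.
  apply run_complete in H as [t H]. apply run_complete in H' as [t' H'].
  apply (run_mono _ _ (max t t')) in H; [|lia].
  apply (run_mono _ _ (max t t')) in H'; [|lia].
  congruence.
Qed.

(** * Total computable functions *)

Lemma eval_rec f g (G : nat -> nat) (H : nat -> nat -> nat -> nat) :
  (forall x, eval f [x] (G x)) ->
  (forall n z x, eval g [n; z; x] (H n z x)) ->
  forall n x, eval (PRec f g) [n; x] (nrec (G x) (fun k r => H k r x) n).
Proof.
  intros Hf Hg n x. induction n as [|n IH]; simpl.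
  - now constructor.
  - now apply ev_recS with (nrec (G x) (fun k r => H k r x) n).
Qed.

Ltac ev_args :=
  lazymatch goal with
  | |- evals nil _ _ => constructor
  | |- evals (_ :: _) _ _ => constructor; [ | ev_args]
  end.

Ltac ev :=
  repeat first
    [ solve [eauto]
    | apply ev_zero
    | apply ev_succ
    | apply ev_proj; reflexivity
    | lazymatch goal with
      | |- eval (PComp _ _) _ _ => eapply ev_comp; [ev_args | ]
      end ].

Definition add_prf : prf := PRec (PProj 0) (PComp PSucc [PProj 1]).

Lemma eval_add n x : eval add_prf [n; x] (n + x).
Proof.
  replace (n + x) with (nrec x (fun k r => S r) n)
    by (induction n; simpl; congruence).
  apply (eval_rec _ _ (fun x => x) (fun k r _ => S r)); intros; ev.
Qed.

(** [eval_rec] carries a parameter, so a recursion with one argument receives it twice. *)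
Definition pred_prf : prf := PComp (PRec PZero (PProj 0)) [PProj 0; PProj 0].

Lemma eval_pred n : eval pred_prf [n] (pred n).
Proof.
  replace (pred n) with (nrec 0 (fun k r => k) n) by (destruct n; reflexivity).
  eapply ev_comp; [ev_args; ev|].
  apply (eval_rec _ _ (fun _ => 0) (fun k _ _ => k)); intros; ev.
Qed.

(** [PRec] recurses on its first argument, here the number of predecessors taken; the subtrahend
    therefore comes first. *)
Definition rsub_prf : prf := PRec (PProj 0) (PComp pred_prf [PProj 1]).

Lemma eval_rsub n x : eval rsub_prf [n; x] (x - n).
Proof.
  replace (x - n) with (nrec x (fun k r => pred r) n)
    by (induction n; simpl; lia).
  apply (eval_rec _ _ (fun x => x) (fun k r _ => pred r)); intros; ev.
  apply eval_pred.
Qed.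

Fixpoint tri (n : nat) : nat := match n with 0 => 0 | S k => tri k + S k end.

Definition tri_prf : prf :=
  PComp (PRec PZero (PComp add_prf [PProj 1; PComp PSucc [PProj 0]])) [PProj 0; PProj 0].

Lemma eval_tri n : eval tri_prf [n] (tri n).
Proof.
  replace (tri n) with (nrec 0 (fun k r => r + S k) n)
    by (induction n; simpl; congruence).
  eapply ev_comp; [ev_args; ev|].
  apply (eval_rec _ _ (fun _ => 0) (fun k r _ => r + S k)); intros; ev.
  apply eval_add.
Qed.

(** Triangular numbers turn the division in [pairN] into a primitive recursion. *)
Lemma pairN_tri i n : pairN i n = tri (i + n) + n.
Proof.
  unfold pairN. f_equal. generalize (i + n). intros m.
  assert (E : m * S m = tri m * 2) by (induction m; simpl; lia).
  rewrite E. apply Nat.div_mul. lia.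
Qed.

Definition pair_prf : prf := PComp add_prf [PComp tri_prf [add_prf]; PProj 1].

Lemma eval_pair i n : eval pair_prf [i; n] (pairN i n).
Proof.
  rewrite pairN_tri.
  eapply ev_comp; [ev_args | apply eval_add].
  - eapply ev_comp; [ev_args; apply eval_add | apply eval_tri].
  - ev.
Qed.

(* [diag z] is the index of the diagonal of the pairing that contains [z]; the truncated subtraction is 1 exactly when the next diagonal begins. *)
Definition diag (z : nat) : nat := nrec 0 (fun k s => s + (1 - (tri (S s) - S k))) z.

Definition diag_prf : prf :=
  PComp (PRec PZero
    (PComp add_prf [PProj 1;
       PComp rsub_prf [PComp rsub_prf [PComp PSucc [PProj 0];
                                       PComp tri_prf [PComp PSucc [PProj 1]]];
                       PComp PSucc [PZero]]]))
    [PProj 0; PProj 0].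

Lemma eval_diag z : eval diag_prf [z] (diag z).
Proof.
  eapply ev_comp; [ev_args; ev|].
  apply (eval_rec _ _ (fun _ => 0) (fun k s _ => s + (1 - (tri (S s) - S k))));
    intros; [ev|].
  eapply ev_comp; [ev_args | apply eval_add]; [ev|].
  eapply ev_comp; [ev_args | apply eval_rsub]; [|ev].
  eapply ev_comp; [ev_args | apply eval_rsub]; [ev|].
  eapply ev_comp; [ev_args | apply eval_tri]; ev.
Qed.

Lemma diag_spec z : tri (diag z) <= z < tri (S (diag z)).
Proof.
  unfold diag. induction z as [|z IH]; [simpl; lia|].
  cbn [nrec]. set (s := nrec _ _ z) in *.
  destruct (le_gt_dec (tri (S s)) (S z)) as [H|H].
  - replace (s + (1 - (tri (S s) - S z))) with (S s) by lia. simpl in *. lia.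
  - replace (s + (1 - (tri (S s) - S z))) with s by lia. lia.
Qed.

Definition pi2 (z : nat) : nat := z - tri (diag z).
Definition pi1 (z : nat) : nat := diag z - pi2 z.

Lemma tri_mono a b : a <= b -> tri a <= tri b.
Proof. induction 1; simpl; lia. Qed.

Lemma diag_pairN i n : diag (pairN i n) = i + n.
Proof.
  rewrite pairN_tri.
  pose proof (diag_spec (tri (i + n) + n)) as H.
  set (s := diag _) in *.
  destruct (lt_eq_lt_dec s (i + n)) as [[L|E]|L]; auto; exfalso.
  - assert (tri (S s) <= tri (i + n)) by (apply tri_mono; lia). lia.
  - assert (tri (S (i + n)) <= tri s) by (apply tri_mono; lia). simpl in *. lia.
Qed.

Lemma pi2_pairN i n : pi2 (pairN i n) = n.
Proof. unfold pi2. rewrite diag_pairN, pairN_tri. lia. Qed.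

Lemma pi1_pairN i n : pi1 (pairN i n) = i.
Proof. unfold pi1. rewrite pi2_pairN, diag_pairN. lia. Qed.

Lemma pairN_pi z : pairN (pi1 z) (pi2 z) = z.
Proof.
  pose proof (diag_spec z) as H. rewrite pairN_tri. unfold pi1, pi2. simpl in H.
  replace (diag z - (z - tri (diag z)) + (z - tri (diag z))) with (diag z) by lia.
  lia.
Qed.

Lemma tri_ge n : n <= tri n.
Proof. induction n; simpl; lia. Qed.

Lemma pairN_ge1 i n : i <= pairN i n.
Proof. rewrite pairN_tri. pose proof (tri_ge (i + n)). lia. Qed.

Lemma pairN_ge2 i n : n <= pairN i n.
Proof. rewrite pairN_tri. lia. Qed.

Definition computable (F : nat -> nat) : Prop := exists e, forall n, eval e [n] (F n).

Lemma computable_ext F G : (forall n, F n = G n) -> computable F -> computable G.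
Proof. intros H [e He]. exists e. intros n. now rewrite <- H. Qed.

Lemma computable_id : computable (fun n => n).
Proof. exists (PProj 0). intros n. ev. Qed.

Lemma computable_const c : computable (fun _ => c).
Proof.
  induction c as [|c [e He]].
  - exists PZero. intros n. ev.
  - exists (PComp PSucc [e]). intros n. eapply ev_comp; [ev_args; apply He|ev].
Qed.

Lemma computable_comp F G : computable F -> computable G -> computable (fun n => F (G n)).
Proof.
  intros [e He] [e' He']. exists (PComp e [e']). intros n.
  eapply ev_comp; [ev_args; apply He'|apply He].
Qed.

Lemma computable_binary e H F G :
  (forall x y, eval e [x; y] (H x y)) ->
  computable F -> computable G -> computable (fun n => H (F n) (G n)).
Proof.
  intros He [f Hf] [g Hg]. exists (PComp e [f; g]). intros n.
  eapply ev_comp; [ev_args; [apply Hf|apply Hg]|apply He].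
Qed.

Lemma computable_S F : computable F -> computable (fun n => S (F n)).
Proof.
  apply (computable_comp S). exists PSucc. intros n. ev.
Qed.

Lemma computable_add F G :
  computable F -> computable G -> computable (fun n => F n + G n).
Proof. apply (computable_binary _ _ F G eval_add). Qed.

Lemma computable_sub F G :
  computable F -> computable G -> computable (fun n => F n - G n).
Proof.
  intros HF HG. exact (computable_binary _ (fun x y => y - x) G F eval_rsub HG HF).
Qed.

Lemma computable_pairN F G :
  computable F -> computable G -> computable (fun n => pairN (F n) (G n)).
Proof. apply (computable_binary _ _ F G eval_pair). Qed.

Lemma computable_pi2 F : computable F -> computable (fun n => pi2 (F n)).
Proof.
  apply (computable_comp pi2). unfold pi2.
  apply computable_sub; [apply computable_id|].
  exists (PComp tri_prf [diag_prf]). intros n.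
  eapply ev_comp; [ev_args; apply eval_diag|apply eval_tri].
Qed.

Lemma computable_pi1 F : computable F -> computable (fun n => pi1 (F n)).
Proof.
  apply (computable_comp pi1). unfold pi1.
  apply computable_sub; [|apply computable_pi2, computable_id].
  exists diag_prf. apply eval_diag.
Qed.

Lemma computable_nrec N G H :
  computable N -> computable G -> computable H ->
  computable (fun n => nrec (G n) (fun k r => H (pairN n (pairN k r))) (N n)).
Proof.
  intros [en HN] [eg HG] [eh HH].
  exists (PComp (PRec eg (PComp eh [PComp pair_prf [PProj 2; PComp pair_prf [PProj 0; PProj 1]]])) [en; PProj 0]).
  intros n. eapply ev_comp; [ev_args; [apply HN|ev]|].
  apply (eval_rec _ _ G (fun k r n => H (pairN n (pairN k r)))); intros; [apply HG|].
  eapply ev_comp; [ev_args|apply HH].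
  eapply ev_comp; [ev_args; [ev|]|apply eval_pair].
  eapply ev_comp; [ev_args; ev|apply eval_pair].
Qed.

(** * Computability between encoded types *)

Class Enc (A : Type) := enc : A -> nat.

#[global] Instance enc_nat : Enc nat := fun n => n.
#[global] Instance enc_bool : Enc bool := fun b => if b then 1 else 0.
#[global] Instance enc_prod {A B} `{Enc A} `{Enc B} : Enc (A * B) :=
  fun p => pairN (enc (fst p)) (enc (snd p)).
#[global] Instance enc_option {A} `{Enc A} : Enc (option A) :=
  fun o => match o with None => 0 | Some a => S (enc a) end.
#[global] Instance enc_list {A} `{Enc A} : Enc (list A) :=
  fix e l := match l with nil => 0 | a :: l' => S (pairN (enc a) (e l')) end.

Lemma enc_code_list (l : list nat) : enc l = code_list l.
Proof. induction l as [|a l IH]; [reflexivity|]. simpl. now rewrite <- IH. Qed.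

(** The tracking function [F] is total on numbers but constrained only on codes of elements of
    [A]. *)
Definition comp {A B} `{Enc A} `{Enc B} (f : A -> B) : Prop :=
  exists F, computable F /\ forall x, F (enc x) = enc (f x).

Lemma computable_of_comp (f : nat -> nat) : comp f -> computable f.
Proof. intros (F & HF & E). now apply (computable_ext F). Qed.

Lemma comp_of_computable (f : nat -> nat) : computable f -> comp f.
Proof. intros H. now exists f. Qed.

Lemma comp_ext {A B} `{Enc A} `{Enc B} (f g : A -> B) :
  (forall x, f x = g x) -> comp f -> comp g.
Proof. intros E (F & HF & H'). exists F. split; [auto|]. intros x. now rewrite <- E. Qed.

Lemma comp_id {A} `{Enc A} : comp (fun x : A => x).
Proof. exists (fun n => n). split; [apply computable_id|reflexivity]. Qed.

Lemma comp_const {A B} `{Enc A} `{Enc B} (b : B) : comp (fun _ : A => b).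
Proof. exists (fun _ => enc b). split; [apply computable_const|reflexivity]. Qed.

Lemma comp_compose {A B C} `{Enc A} `{Enc B} `{Enc C} (g : B -> C) (f : A -> B) :
  comp g -> comp f -> comp (fun x => g (f x)).
Proof.
  intros (G & HG & EG) (F & HF & EF). exists (fun n => G (F n)).
  split; [now apply computable_comp|]. intros x. now rewrite EF, EG.
Qed.

Section Lifted.
Context {X : Type} `{EX : Enc X}.

Lemma comp_pair {A B} `{Enc A} `{Enc B} (f : X -> A) (g : X -> B) :
  comp f -> comp g -> comp (fun x => (f x, g x)).
Proof.
  intros (F & HF & EF) (G & HG & EG). exists (fun n => pairN (F n) (G n)).
  split; [now apply computable_pairN|]. intros x. now rewrite EF, EG.
Qed.

Lemma comp_fst {A B} `{Enc A} `{Enc B} (f : X -> A * B) :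
  comp f -> comp (fun x => fst (f x)).
Proof.
  intros (F & HF & EF). exists (fun n => pi1 (F n)).
  split; [now apply computable_pi1|]. intros x. rewrite EF. apply pi1_pairN.
Qed.

Lemma comp_snd {A B} `{Enc A} `{Enc B} (f : X -> A * B) :
  comp f -> comp (fun x => snd (f x)).
Proof.
  intros (F & HF & EF). exists (fun n => pi2 (F n)).
  split; [now apply computable_pi2|]. intros x. rewrite EF. apply pi2_pairN.
Qed.

Lemma comp_app2 {A B C} `{Enc A} `{Enc B} `{Enc C} (h : A -> B -> C)
    (f : X -> A) (g : X -> B) :
  comp (fun p => h (fst p) (snd p)) -> comp f -> comp g -> comp (fun x => h (f x) (g x)).
Proof.
  intros Hh Hf Hg.
  exact (comp_compose (fun p => h (fst p) (snd p)) (fun x => (f x, g x)) Hh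
           (comp_pair _ _ Hf Hg)).
Qed.

Lemma comp_nrec {B} `{Enc B} (n : X -> nat) (g : X -> B) (h : X -> nat -> B -> B) :
  comp n -> comp g ->
  comp (fun p : X * (nat * B) => h (fst p) (fst (snd p)) (snd (snd p))) ->
  comp (fun x => nrec (g x) (h x) (n x)).
Proof.
  intros (N & HN & EN) (G & HG & EG) (K & HK & EK).
  exists (fun z => nrec (G z) (fun k r => K (pairN z (pairN k r))) (N z)).
  split; [now apply computable_nrec|].
  intros x. rewrite EN, EG. change (enc (n x)) with (n x).
  induction (n x) as [|k IH]; simpl; [reflexivity|].
  rewrite IH. apply (EK (x, (k, nrec (g x) (h x) k))).
Qed.

(** Case analysis is a recursion whose last step alone fixes the value. As 0 codes [None], [nil] and
    [false], and successors code the other values, this serves for matches on all these types. *)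
Lemma computable_case N G H :
  computable N -> computable G -> computable H ->
  computable (fun n => match N n with 0 => G n | S k => H (pairN n k) end).
Proof.
  intros HN HG HH.
  apply (computable_ext
    (fun n => nrec (G n) (fun k r =>
       (fun z => H (pairN (pi1 z) (pi1 (pi2 z)))) (pairN n (pairN k r))) (N n))).
  - intros n. destruct (N n); simpl; [reflexivity|].
    now rewrite pi2_pairN, !pi1_pairN.
  - apply (computable_nrec N G (fun z => H (pairN (pi1 z) (pi1 (pi2 z))))); auto.
    apply (computable_comp H); auto.
    apply computable_pairN; [apply computable_pi1, computable_id|].
    apply computable_pi1, computable_pi2, computable_id.
Qed.

Lemma comp_match_nat {B} `{Enc B} (n : X -> nat) (g : X -> B) (h : X -> nat -> B) :
  comp n -> comp g -> comp (fun p => h (fst p) (snd p)) ->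
  comp (fun x => match n x with 0 => g x | S k => h x k end).
Proof.
  intros (N & HN & EN) (G & HG & EG) (K & HK & EK). eexists.
  split; [exact (computable_case N G K HN HG HK)|].
  intros x. cbv beta. rewrite EN. change (enc (n x)) with (n x).
  destruct (n x) as [|k]; [apply EG|apply (EK (x, k))].
Qed.

Lemma comp_match_option {A B} `{Enc A} `{Enc B} (o : X -> option A) (g : X -> B)
    (h : X -> A -> B) :
  comp o -> comp g -> comp (fun p => h (fst p) (snd p)) ->
  comp (fun x => match o x with None => g x | Some a => h x a end).
Proof.
  intros (N & HN & EN) (G & HG & EG) (K & HK & EK). eexists.
  split; [exact (computable_case N G K HN HG HK)|].
  intros x. cbv beta. rewrite EN.
  destruct (o x) as [a|]; [apply (EK (x, a))|apply EG].
Qed.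

Lemma comp_match_list {A B} `{Enc A} `{Enc B} (l : X -> list A) (g : X -> B)
    (h : X -> A -> list A -> B) :
  comp l -> comp g ->
  comp (fun p : X * (A * list A) => h (fst p) (fst (snd p)) (snd (snd p))) ->
  comp (fun x => match l x with nil => g x | a :: l' => h x a l' end).
Proof.
  intros (N & HN & EN) (G & HG & EG) (K & HK & EK). eexists.
  split; [exact (computable_case N G K HN HG HK)|].
  intros x. cbv beta. rewrite EN.
  destruct (l x) as [|a l']; [apply EG|apply (EK (x, (a, l')))].
Qed.

Lemma comp_if {B} `{Enc B} (c : X -> bool) (g h : X -> B) :
  comp c -> comp g -> comp h -> comp (fun x => if c x then g x else h x).
Proof.
  intros (N & HN & EN) (G & HG & EG) (K & HK & EK). eexists. split.
  (* [false] has code 0, so the two branches are swapped. *)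
  - apply (computable_case N K (fun z => G (pi1 z)) HN HK).
    apply computable_comp; [exact HG|apply computable_pi1, computable_id].
  - intros x. cbv beta. rewrite EN.
    destruct (c x); cbn [enc enc_bool]; [rewrite pi1_pairN; apply EG|apply EK].
Qed.

Lemma comp_S (f : X -> nat) : comp f -> comp (fun x => S (f x)).
Proof.
  apply comp_compose, comp_of_computable, (computable_S (fun n => n)), computable_id.
Qed.

Lemma comp_add (f g : X -> nat) : comp f -> comp g -> comp (fun x => f x + g x).
Proof.
  intros (F & HF & EF) (G & HG & EG). exists (fun n => F n + G n).
  split; [now apply computable_add|]. intros x. now rewrite EF, EG.
Qed.

Lemma comp_sub (f g : X -> nat) : comp f -> comp g -> comp (fun x => f x - g x).
Proof.
  intros (F & HF & EF) (G & HG & EG). exists (fun n => F n - G n).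
  split; [now apply computable_sub|]. intros x. now rewrite EF, EG.
Qed.

Lemma comp_pairN (f g : X -> nat) : comp f -> comp g -> comp (fun x => pairN (f x) (g x)).
Proof.
  intros (F & HF & EF) (G & HG & EG). exists (fun n => pairN (F n) (G n)).
  split; [now apply computable_pairN|]. intros x. now rewrite EF, EG.
Qed.

Lemma comp_pi1 (f : X -> nat) : comp f -> comp (fun x => pi1 (f x)).
Proof. apply comp_compose, comp_of_computable, computable_pi1, computable_id. Qed.

Lemma comp_pi2 (f : X -> nat) : comp f -> comp (fun x => pi2 (f x)).
Proof. apply comp_compose, comp_of_computable, computable_pi2, computable_id. Qed.

Lemma comp_leb (f g : X -> nat) : comp f -> comp g -> comp (fun x => f x <=? g x).
Proof.
  intros (F & HF & EF) (G & HG & EG). exists (fun n => 1 - (F n - G n)). split.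
  - apply computable_sub; [apply computable_const|now apply computable_sub].
  - intros x. rewrite EF, EG. unfold enc, enc_nat, enc_bool.
    destruct (Nat.leb_spec (f x) (g x)); lia.
Qed.

Lemma comp_eqb (f g : X -> nat) : comp f -> comp g -> comp (fun x => f x =? g x).
Proof.
  intros (F & HF & EF) (G & HG & EG).
  exists (fun n => 1 - ((F n - G n) + (G n - F n))). split.
  - apply computable_sub; [apply computable_const|].
    apply computable_add; now apply computable_sub.
  - intros x. rewrite EF, EG. unfold enc, enc_nat, enc_bool.
    destruct (Nat.eqb_spec (f x) (g x)); lia.
Qed.

Lemma comp_andb (f g : X -> bool) : comp f -> comp g -> comp (fun x => f x && g x)%bool.
Proof. intros Hf Hg. apply (comp_if f g (fun _ => false)); auto using comp_const. Qed.

Lemma comp_Some {A} `{Enc A} (f : X -> A) : comp f -> comp (fun x => Some (f x)).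
Proof.
  intros (F & HF & EF). exists (fun n => S (F n)).
  split; [now apply computable_S|]. intros x. now rewrite EF.
Qed.

Lemma comp_cons {A} `{Enc A} (f : X -> A) (g : X -> list A) :
  comp f -> comp g -> comp (fun x => f x :: g x).
Proof.
  intros (F & HF & EF) (G & HG & EG). exists (fun n => S (pairN (F n) (G n))).
  split; [now apply computable_S, computable_pairN|]. intros x. now rewrite EF, EG.
Qed.

End Lifted.

(** A hook, redefined when further operations have been shown computable. *)
Ltac comp_extra := fail.

(* Dispatches on the head symbol of the body: plain [apply] may unfold constants without end. *)
Ltac comp_step :=
  cbv beta;
  first
    [ assumption
    | comp_extra
    | match goal with
      | Hf : comp ?f |- comp (fun x => ?f _) => apply (comp_compose f _ Hf)
      end
    | lazymatch goal with
      | |- comp (fun x => x) => apply comp_id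
      | |- comp fst => apply (comp_fst (fun x => x))
      | |- comp snd => apply (comp_snd (fun x => x))
      | |- comp pi1 => apply (comp_pi1 (fun x => x))
      | |- comp pi2 => apply (comp_pi2 (fun x => x))
      | |- comp (fun x => fst _) => apply comp_fst
      | |- comp (fun x => snd _) => apply comp_snd
      | |- comp (fun x => (_, _)) => apply comp_pair
      | |- comp (fun x => S _) => first [apply comp_const | apply comp_S]
      | |- comp (fun x => _ + _) => apply comp_add
      | |- comp (fun x => _ - _) => apply comp_sub
      | |- comp (fun x => pairN _ _) => apply comp_pairN
      | |- comp (fun x => pi1 _) => apply comp_pi1
      | |- comp (fun x => pi2 _) => apply comp_pi2
      | |- comp (fun x => _ <=? _) => apply comp_leb
      | |- comp (fun x => _ =? _) => apply comp_eqb
      | |- comp (fun x => andb _ _) => apply comp_andb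
      | |- comp (fun x => Some _) => apply comp_Some
      | |- comp (fun x => _ :: _) => apply comp_cons
      | |- comp (fun x => match _ with 0 => _ | S _ => _ end) => apply comp_match_nat
      | |- comp (fun x => match _ with None => _ | Some _ => _ end) =>
          apply comp_match_option
      | |- comp (fun x => match _ with nil => _ | _ :: _ => _ end) =>
          apply comp_match_list
      | |- comp (fun x => if _ then _ else _) => apply comp_if
      | |- comp (fun x => nrec _ _ _) => apply comp_nrec
      | |- comp (fun x => ?b) => apply comp_const
      end ].

Ltac computes := repeat comp_step.

(** * Computable list operations *)

Section ListOps.
Context {X : Type} `{EX : Enc X}.

Definition fold_step {A B} (f : B -> A -> B) (s : list A * B) : list A * B :=
  match fst s with nil => (nil, snd s) | a :: l => (l, f (snd s) a) end.

(** The step is idle on the empty list, so any bound on the length may serve as the number of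
    iterations. *)
Lemma nrec_fold_step {A B} (f : B -> A -> B) n :
  forall l b, length l <= n ->
  nrec (l, b) (fun _ s => fold_step f s) n = (nil, fold_left f l b).
Proof.
  assert (Hs : forall n s, nrec s (fun _ s => fold_step f s) (S n)
                           = nrec (fold_step f s) (fun _ s => fold_step f s) n).
  { induction n0 as [|m IH]; intros s; [reflexivity|].
    cbn [nrec] in *. now rewrite IH. }
  induction n as [|n IH]; intros l b Hl.
  - destruct l; [reflexivity|simpl in Hl; lia].
  - rewrite Hs. destruct l as [|a l]; cbn [fold_step fst snd].
    + rewrite IH; [reflexivity|simpl; lia].
    + rewrite IH; [reflexivity|simpl in Hl; lia].
Qed.

Lemma length_le_enc {A} `{Enc A} (l : list A) : length l <= enc l.
Proof.
  induction l as [|a l IH]; [simpl; lia|].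
  change (S (length l) <= S (pairN (enc a) (enc l))).
  pose proof (pairN_ge2 (enc a) (enc l)). lia.
Qed.

Lemma comp_enc {A} `{Enc A} (f : X -> A) : comp f -> comp (fun x => enc (f x)).
Proof. intros (F & HF & EF). now exists F. Qed.

(** The code of the list is the iteration bound: the length is itself shown computable only later,
    as a fold. *)
Lemma comp_fold_left {A B} `{Enc A} `{Enc B} (f : X -> B -> A -> B)
    (l : X -> list A) (b : X -> B) :
  comp l -> comp b ->
  comp (fun p : X * (B * A) => f (fst p) (fst (snd p)) (snd (snd p))) ->
  comp (fun x => fold_left (f x) (l x) (b x)).
Proof.
  intros Hl Hb Hf.
  apply (comp_ext (fun x => snd (nrec (l x, b x) (fun _ s => fold_step (f x) s) (enc (l x))))).
  { intros x. now rewrite nrec_fold_step by apply length_le_enc. }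
  unfold fold_step. pose proof (comp_enc _ Hl). computes.
  apply (comp_compose (fun p : X * (B * A) => f (fst p) (fst (snd p)) (snd (snd p)))
    (fun x : X * (nat * (list A * B)) * (A * list A) =>
       (fst (fst x), (snd (snd (snd (fst x))), fst (snd x))))); computes.
Qed.

Lemma comp_rev {A} `{Enc A} (l : X -> list A) : comp l -> comp (fun x => rev (l x)).
Proof.
  intros Hl. apply (comp_ext (fun x => fold_left (fun acc a => a :: acc) (l x) nil)).
  - intros x. rewrite <- (app_nil_r (rev (l x))).
    generalize (@nil A) as acc. induction (l x) as [|a l' IH]; intros acc; [reflexivity|].
    simpl. rewrite IH, <- app_assoc. reflexivity.
  - apply (comp_fold_left (fun _ acc a => a :: acc)); computes.
Qed.

Lemma comp_app {A} `{Enc A} (l m : X -> list A) :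
  comp l -> comp m -> comp (fun x => l x ++ m x).
Proof.
  intros Hl Hm.
  apply (comp_ext (fun x => fold_left (fun acc a => a :: acc) (rev (l x)) (m x))).
  - intros x. rewrite <- (rev_involutive (l x)) at 2.
    generalize (m x) as acc. induction (rev (l x)) as [|a l' IH]; intros acc; [reflexivity|].
    simpl. rewrite IH, <- app_assoc. reflexivity.
  - apply (comp_fold_left (fun _ acc a => a :: acc)); computes. now apply comp_rev.
Qed.

Lemma comp_length {A} `{Enc A} (l : X -> list A) : comp l -> comp (fun x => length (l x)).
Proof.
  intros Hl. apply (comp_ext (fun x => fold_left (fun n _ => S n) (l x) 0)).
  - intros x. rewrite <- (Nat.add_0_r (length (l x))).
    generalize 0. induction (l x) as [|a l' IH]; intros n; [reflexivity|].
    simpl. rewrite IH. lia.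
  - apply (comp_fold_left (fun _ n _ => S n)); computes.
Qed.

Lemma comp_find {A} `{Enc A} (P : X -> A -> bool) (l : X -> list A) :
  comp (fun p => P (fst p) (snd p)) -> comp l -> comp (fun x => find (P x) (l x)).
Proof.
  intros HP Hl.
  apply (comp_ext (fun x => fold_left (fun o a =>
           match o with
           | None => if P x a then Some a else None
           | Some b => Some b end) (l x) None)).
  - intros x.
    assert (G : forall l' b, fold_left (fun o a => match o with
               | None => if P x a then Some a else None
               | Some b => Some b end) l' (Some b) = Some b)
      by (induction l' as [|a l' IH]; intros b; [reflexivity|apply IH]).
    induction (l x) as [|a l' IH]; [reflexivity|].
    simpl. destruct (P x a); [apply G|apply IH].
  - apply (comp_fold_left (fun x o a => match o with
           | None => if P x a then Some a else None
           | Some b => Some b end)); computes.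
    apply (comp_app2 P); computes.
Qed.

Lemma comp_repeat {A} `{Enc A} (a : X -> A) (n : X -> nat) :
  comp a -> comp n -> comp (fun x => repeat (a x) (n x)).
Proof.
  intros Ha Hn. apply (comp_ext (fun x => nrec nil (fun _ r => a x :: r) (n x))).
  - intros x. induction (n x) as [|k IH]; simpl; congruence.
  - computes.
Qed.

Lemma comp_last {A} `{Enc A} (l : X -> list A) (d : X -> A) :
  comp l -> comp d -> comp (fun x => last (l x) (d x)).
Proof.
  intros Hl Hd. apply (comp_ext (fun x => fold_left (fun _ a => a) (l x) (d x))).
  - intros x. generalize (d x). induction (l x) as [|a l' IH]; intros b; [reflexivity|].
    cbn [fold_left]. rewrite IH. destruct l' as [|a' l']; [reflexivity|].
    clear IH. cbn [last]. revert a'.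
    induction l' as [|a'' l' IH']; intros a'; [reflexivity|]. apply (IH' a'').
  - apply (comp_fold_left (fun _ _ a => a)); computes.
Qed.

Lemma comp_firstn {A} `{Enc A} (n : X -> nat) (l : X -> list A) :
  comp n -> comp l -> comp (fun x => firstn (n x) (l x)).
Proof.
  intros Hn Hl.
  apply (comp_ext (fun x => rev (snd (fold_left (fun (s : nat * list A) a =>
           match fst s with 0 => s | S k => (k, a :: snd s) end) (l x) (n x, nil))))).
  - intros x.
    assert (G : forall l' m acc,
      rev (snd (fold_left (fun (s : nat * list A) a =>
           match fst s with 0 => s | S k => (k, a :: snd s) end) l' (m, acc)))
      = rev acc ++ firstn m l').
    { induction l' as [|a l' IH]; intros m acc; simpl.
      - now rewrite firstn_nil, app_nil_r.
      - destruct m as [|m]; simpl; rewrite IH; simpl; [reflexivity|].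
        now rewrite <- app_assoc. }
    apply G.
  - apply comp_rev, comp_snd.
    apply (comp_fold_left (fun _ (s : nat * list A) a =>
           match fst s with 0 => s | S k => (k, a :: snd s) end)); computes.
Qed.

Lemma comp_nth_error {A} `{Enc A} (i : nat) : forall l : X -> list A,
  comp l -> comp (fun x => nth_error (l x) i).
Proof.
  induction i as [|i IH]; intros l Hl.
  - apply (comp_ext (fun x => match l x with nil => None | a :: _ => Some a end)).
    + intros x. now destruct (l x).
    + computes.
  - apply (comp_ext (fun x => nth_error (match l x with nil => nil | _ :: l' => l' end) i)).
    + intros x. destruct (l x); [destruct i|]; reflexivity.
    + apply IH. computes.
Qed.

End ListOps.

Ltac comp_list_op :=
  lazymatch goal with
  | |- comp (fun x => _ ++ _) => apply comp_app
  | |- comp (fun x => length _) => apply comp_length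
  | |- comp (fun x => repeat _ _) => apply comp_repeat
  | |- comp (fun x => last _ _) => apply comp_last
  | |- comp (fun x => firstn _ _) => apply comp_firstn
  | |- comp (fun x => find _ _) => apply comp_find
  | |- comp (fun x => nth_error _ _) => apply comp_nth_error
  end.

Ltac comp_extra ::= comp_list_op.

(** Induction on the program settles each fixed [e]. This suffices, as only [U] is simulated below,
    and it avoids building a universal program. *)
Lemma comp_run (e : prf) : comp (fun p : nat * list nat => run e (fst p) (snd p)).
Proof.
  induction e as [| |i|f gs IHf IHgs|f g IHf IHg|f IHf] using prf_nested_ind.
  - cbn [run]. computes.
  - cbn [run]. computes.
  - cbn [run]. computes.
  - apply (comp_ext (fun p : nat * list nat =>
      match run_list gs (fst p) (snd p) with
      | Some ys => run f (fst p) ys | None => None end)).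
    { intros p. now rewrite run_comp. }
    assert (H : comp (fun p : nat * list nat => run_list gs (fst p) (snd p))).
    { induction IHgs as [|g gs Hg _ IH]; cbn [run_list]; computes.
      apply (comp_app2 (run_list gs)); computes. }
    computes. apply (comp_app2 (run f)); computes.
  - cbn [run]. computes.
    + apply (comp_app2 (run f)); computes.
    + apply (comp_app2 (run g)); computes.
  - cbn [run]. unfold mu_step. computes.
    apply (comp_app2 (run f)); computes.
Qed.

(** * Binary strings *)

(** Works on codes: each step removes the first bit of the string coded by [u], and [u] itself
    bounds the number of bits. *)
Definition blen (u : nat) : nat :=
  snd (nrec (u, 0) (fun _ s => match fst s with 0 => s | S v => (Nat.div2 v, S (snd s)) end) u).

(* Removes the prefix [0^j 1]; the flag tells whether the digit 1 was found. *)
Definition strip (u : nat) : nat * bool :=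
  nrec (u, false)
    (fun _ s => if snd s then s else
                match fst s with 0 => s | S v => (Nat.div2 v, Nat.odd v) end) u.

(** The block [0^j 1] is self-delimiting: padding adds [j + 1] bits and keeps a domain
    prefix-free. *)
Definition pad (j : nat) (s : list bool) : list bool := repeat false j ++ true :: s.

Lemma div2_bit n (b : bool) : Nat.div2 (2 * n + (if b then 1 else 0)) = n.
Proof.
  destruct b.
  - replace (2 * n + 1) with (S (2 * n)) by lia. apply Nat.div2_succ_double.
  - rewrite Nat.add_0_r. apply Nat.div2_double.
Qed.

Lemma odd_bit n (b : bool) : Nat.odd (2 * n + (if b then 1 else 0)) = b.
Proof.
  destruct b.
  - apply Nat.odd_odd.
  - rewrite Nat.add_0_r. apply Nat.odd_even.
Qed.

Lemma bit_div2 v : v = 2 * Nat.div2 v + (if Nat.odd v then 1 else 0).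
Proof. rewrite (Nat.div2_odd v) at 1. now destruct (Nat.odd v). Qed.

Lemma code_bits_surj u : exists s, code_bits s = u.
Proof.
  induction u as [[|v] IH] using lt_wf_ind; [now exists nil|].
  destruct (IH (Nat.div2 v)) as [s Hs].
  { pose proof (bit_div2 v). lia. }
  exists (Nat.odd v :: s). simpl code_bits. rewrite Hs. f_equal. symmetry. apply bit_div2.
Qed.

Lemma code_bits_inj s s' : code_bits s = code_bits s' -> s = s'.
Proof.
  revert s'. induction s as [|b s IH]; intros [|b' s']; simpl code_bits; try discriminate.
  - reflexivity.
  - intros [= H]. f_equal.
    + rewrite <- (odd_bit (code_bits s) b), <- (odd_bit (code_bits s') b').
      simpl in *. now rewrite H.
    + apply IH. rewrite <- (div2_bit (code_bits s) b), <- (div2_bit (code_bits s') b').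
      simpl in *. now rewrite H.
Qed.

(** [S (code_bits s)] has [length s + 1] binary digits, the leading one being 1. *)
Lemma code_bits_ub s : S (code_bits s) < 2 ^ S (length s).
Proof. induction s as [|b s IH]; simpl in *; [lia|]. destruct b; lia. Qed.

Lemma length_le_code_bits s : length s <= code_bits s.
Proof. induction s as [|b s IH]; simpl in *; [lia|]. lia. Qed.

Lemma nrec_succ_front {B} (g : B -> B) n b :
  nrec b (fun _ s => g s) (S n) = nrec (g b) (fun _ s => g s) n.
Proof. induction n as [|n IH]; [reflexivity|]. cbn [nrec] in *. now rewrite IH. Qed.

Lemma blen_code_bits s : blen (code_bits s) = length s.
Proof.
  unfold blen.
  set (g := fun s : nat * nat => match fst s with 0 => s | S v => (Nat.div2 v, S (snd s)) end).
  assert (G : forall n s k, length s <= n ->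
            snd (nrec (code_bits s, k) (fun _ s => g s) n) = k + length s).
  { induction n as [|n IH]; intros s' k Hl.
    - destruct s'; [simpl; lia|simpl in Hl; lia].
    - rewrite nrec_succ_front. destruct s' as [|b s'].
      + change (g (code_bits nil, k)) with (code_bits nil, k).
        rewrite (IH nil k); simpl; lia.
      + change (g (code_bits (b :: s'), k))
          with (Nat.div2 (2 * code_bits s' + (if b then 1 else 0)), S k).
        rewrite div2_bit, IH by (simpl in Hl; lia). simpl. lia. }
  apply (G _ s 0), length_le_code_bits.
Qed.

Lemma strip_step_found n u :
  nrec (u, true) (fun _ s => if snd s then s else
      match fst s with 0 => s | S v => (Nat.div2 v, Nat.odd v) end) n = (u, true).
Proof. induction n as [|n IH]; [reflexivity|]. cbn [nrec]. now rewrite IH. Qed.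

Lemma strip_pad j s : strip (code_bits (pad j s)) = (code_bits s, true).
Proof.
  unfold strip.
  assert (G : forall n j, j < n ->
    nrec (code_bits (pad j s), false) (fun _ s => if snd s then s else
      match fst s with 0 => s | S v => (Nat.div2 v, Nat.odd v) end) n = (code_bits s, true)).
  { induction n as [|n IH]; intros i Hi; [lia|].
    rewrite (nrec_succ_front (fun s : nat * bool => if snd s then s else
      match fst s with 0 => s | S v => (Nat.div2 v, Nat.odd v) end)).
    destruct i as [|i].
    - change (pad 0 s) with (true :: s). cbn [snd fst code_bits].
      rewrite (div2_bit _ true), (odd_bit _ true). apply strip_step_found.
    - change (pad (S i) s) with (false :: pad i s). cbn [snd fst code_bits].
      rewrite (div2_bit _ false), (odd_bit _ false). apply IH. lia. }
  apply G.
  assert (length (pad j s) <= code_bits (pad j s)) by apply length_le_code_bits.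
  unfold pad in *. rewrite length_app, repeat_length in *. simpl in *. lia.
Qed.

Lemma strip_true w v :
  strip (code_bits w) = (v, true) -> exists j s, w = pad j s /\ v = code_bits s.
Proof.
  (* The number of iterations is separated from the string so that the induction runs on it
     alone. *)
  unfold strip. generalize (code_bits w) at 2 as n.
  intros n. revert w. induction n as [|n IH]; intros w; [discriminate|].
  rewrite (nrec_succ_front (fun s : nat * bool => if snd s then s else
      match fst s with 0 => s | S v => (Nat.div2 v, Nat.odd v) end)).
  destruct w as [|b w]; cbn [snd fst code_bits].
  - intros H. apply (IH nil) in H. exact H.
  - rewrite div2_bit, odd_bit. destruct b.
    + rewrite strip_step_found. intros [= <-]. now exists 0, w.
    + intros H. apply IH in H as (j & s & -> & ->). now exists (S j), s.
Qed.

(** The position of the first digit 1 determines [j]. *)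
Lemma pad_prefix j s j' s' :
  is_prefix (pad j s) (pad j' s') -> j = j' /\ is_prefix s s'.
Proof.
  intros [r Hr]. unfold pad in Hr. revert j' Hr.
  induction j as [|j IH]; intros [|j'] Hr; simpl in Hr; try discriminate.
  - injection Hr as Hr. split; [reflexivity|now exists r].
  - injection Hr as Hr. destruct (IH _ Hr) as [-> H]. auto.
Qed.

Lemma pad_length j s : length (pad j s) = S (j + length s).
Proof. unfold pad. rewrite length_app, repeat_length. simpl. lia. Qed.

Lemma comp_odd {X} `{Enc X} (f : X -> nat) : comp f -> comp (fun x => Nat.odd (f x)).
Proof.
  intros Hf.
  apply (comp_ext (fun x => nrec false (fun _ r => if r then false else true) (f x))).
  - intros x. induction (f x) as [|k IH]; [reflexivity|].
    cbn [nrec]. rewrite IH, Nat.odd_succ, <- Nat.negb_odd. now destruct (Nat.odd k).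
  - computes.
Qed.

Lemma comp_div2 {X} `{Enc X} (f : X -> nat) : comp f -> comp (fun x => Nat.div2 (f x)).
Proof.
  intros Hf.
  (* The half of a number counts the odd numbers below it. *)
  apply (comp_ext (fun x => nrec 0 (fun k r => if Nat.odd k then S r else r) (f x))).
  - intros x. induction (f x) as [|k IH]; [reflexivity|].
    cbn [nrec]. rewrite IH.
    pose proof (bit_div2 k) as H1. pose proof (bit_div2 (S k)) as H2.
    rewrite Nat.odd_succ, <- Nat.negb_odd in H2.
    destruct (Nat.odd k); simpl negb in H2; cbv iota in *; lia.
  - computes. apply comp_odd. computes.
Qed.

Lemma comp_blen {X} `{Enc X} (f : X -> nat) : comp f -> comp (fun x => blen (f x)).
Proof. intros Hf. unfold blen. computes. apply comp_div2. computes. Qed.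

Lemma comp_strip {X} `{Enc X} (f : X -> nat) : comp f -> comp (fun x => strip (f x)).
Proof.
  intros Hf. unfold strip. computes; [apply comp_div2|apply comp_odd]; computes.
Qed.

Lemma comp_run_app {X} `{Enc X} (e : prf) (t : X -> nat) (l : X -> list nat) :
  comp t -> comp l -> comp (fun x => run e (t x) (l x)).
Proof. intros Ht Hl. apply (comp_app2 (run e)); auto using comp_run. Qed.

Ltac comp_bit_op :=
  lazymatch goal with
  | |- comp (fun x => blen _) => apply comp_blen
  | |- comp (fun x => strip _) => apply comp_strip
  | |- comp (fun x => run _ _ _) => apply comp_run_app
  end.

Ltac comp_extra ::= first [comp_list_op | comp_bit_op].

(** * Prefix-free machines and complexity *)

(** The searching machines below are instances of this scheme: find the least stage that passes the
    test [G], then output [H]. *)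
Lemma mu_machine (G : nat * nat -> bool) (H : nat * nat -> nat) :
  comp G -> comp H ->
  exists e, forall u y,
    eval e [u] y <->
    exists t, G (t, u) = true /\ (forall t', t' < t -> G (t', u) = false) /\ y = H (t, u).
Proof.
  intros HG HH.
  assert (CG : computable (fun z => if G (pi1 z, pi2 z) then 0 else 1)).
  { apply computable_of_comp. computes. }
  assert (CH : computable (fun z => H (pi1 z, pi2 z))).
  { apply computable_of_comp, (comp_compose H); computes. }
  destruct CG as [eG EG]. destruct CH as [eH EH].
  assert (EG' : forall t u, eval (PComp eG [pair_prf]) [t; u] (if G (t, u) then 0 else 1)).
  { intros t u. eapply ev_comp; [ev_args; apply eval_pair|].
    pose proof (EG (pairN t u)) as E. now rewrite pi1_pairN, pi2_pairN in E. }
  set (m := PMu (PComp eG [pair_prf])).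
  assert (Em : forall u t, G (t, u) = true -> (forall t', t' < t -> G (t', u) = false) ->
                 eval m [u] t).
  { intros u t H1 H2. apply ev_mu.
    - pose proof (EG' t u) as E. now rewrite H1 in E.
    - intros t' Ht'. exists 0. pose proof (EG' t' u) as E. now rewrite H2 in E by assumption. }
  exists (PComp eH [PComp pair_prf [m; PProj 0]]).
  assert (Ee : forall u t, eval m [u] t ->
            eval (PComp eH [PComp pair_prf [m; PProj 0]]) [u] (H (t, u))).
  { intros u t Ht.
    eapply ev_comp; [ev_args|].
    - eapply ev_comp; [ev_args; [exact Ht|ev]|apply eval_pair].
    - pose proof (EH (pairN t u)) as E. now rewrite pi1_pairN, pi2_pairN in E. }
  intros u y. split.
  - intros E.
    (* Inverting the evaluation of the composite shows that the search [m] has halted. *)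
    assert (Hm : exists t, eval m [u] t).
    { inversion E as [| | |f gs xs ys z Hgs _| | |]; subst.
      inversion Hgs as [|g gs xs z' zs Hg _]; subst.
      inversion Hg as [| | |f' gs' xs' ys' z'' Hgs' _| | |]; subst.
      inversion Hgs'; subst. eauto. }
    destruct Hm as [t Ht]. exists t.
    assert (F : G (t, u) = true /\ (forall t', t' < t -> G (t', u) = false)).
    { inversion Ht as [| | | | | |f xs n H0 Hlt]; subst. split.
      - pose proof (eval_det _ _ _ _ H0 (EG' t u)). now destruct (G (t, u)).
      - intros t' Ht'. destruct (Hlt t' Ht') as [k Hk].
        pose proof (eval_det _ _ _ _ Hk (EG' t' u)). now destruct (G (t', u)). }
    destruct F as [F1 F2]. repeat split; auto.
    apply (eval_det _ _ _ _ E). auto.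
  - intros (t & H1 & H2 & ->). auto.
Qed.

(** A known successful stage [t] makes the search halt, though possibly at an earlier stage [t0]. *)
Lemma mu_machine_total (G : nat * nat -> bool) (H : nat * nat -> nat) e :
  (forall u y, eval e [u] y <->
    exists t, G (t, u) = true /\ (forall t', t' < t -> G (t', u) = false) /\ y = H (t, u)) ->
  forall u t, G (t, u) = true ->
  exists t0, t0 <= t /\ G (t0, u) = true /\ eval e [u] (H (t0, u)).
Proof.
  intros He u t.
  induction t as [t IH] using lt_wf_ind. intros Ht.
  destruct (classic (exists t', t' < t /\ G (t', u) = true)) as [(t' & L & E)|N].
  - destruct (IH t' L E) as (t0 & ? & ? & ?). exists t0. repeat split; auto. lia.
  - exists t. repeat split; auto. apply He. exists t. repeat split; auto.
    intros t' L. destruct (G (t', u)) eqn:E; [|reflexivity].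
    exfalso. eauto.
Qed.

Section Complexity.
Variables (U : prf) (HU : optimal_pf_machine U).

Lemma every_number_described y : exists s, runs U s y.
Proof.
  (* [uz t] is the code of [0^t 1]; the machine taking [0^t 1] to [t] is prefix-free, so [U]
     simulates it. *)
  set (uz := fun t => nrec 2 (fun _ r => S (r + r)) t).
  assert (Euz : forall t, uz t = code_bits (pad t nil)).
  { induction t as [|t IH]; [reflexivity|].
    change (pad (S t) nil) with (false :: pad t nil). cbn [code_bits uz nrec].
    fold (uz t). rewrite IH. lia. }
  destruct (mu_machine (fun p => snd p =? uz (fst p)) (fun p => fst p)) as [e He].
  - unfold uz. computes.
  - computes.
  - assert (Hs : forall s z, runs e s z <-> s = pad z nil).
    { intros s z. unfold runs. rewrite He. cbn [fst snd]. split.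
      - intros (t & E & _ & ->). apply Nat.eqb_eq in E.
        rewrite Euz in E. now apply code_bits_inj.
      - intros ->. exists z. repeat split.
        + apply Nat.eqb_eq. now rewrite Euz.
        + intros t' L. apply Nat.eqb_neq. rewrite Euz. intros E.
          apply code_bits_inj, (f_equal (@length bool)) in E.
          rewrite !pad_length in E. simpl in E. lia. }
    destruct (proj2 HU e) as [c Hc].
    + intros s t [z Hz] [z' Hz']. apply Hs in Hz. apply Hs in Hz'. subst.
      intros P. apply pad_prefix in P as [-> _]. reflexivity.
    + destruct (Hc (pad y nil) y) as (t & Ht & _); [now apply Hs|]. eauto.
Qed.

(** Some description exists, hence a shortest one, so the choice made in [Kc] is meaningful. *)
Lemma Kc_spec y :
  (exists s, runs U s y /\ length s = Kc U y) /\
  (forall s, runs U s y -> Kc U y <= length s).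
Proof.
  unfold Kc. apply epsilon_spec.
  destruct (every_number_described y) as [s Hs].
  assert (G : forall n s, length s = n -> runs U s y ->
    exists k, (exists s, runs U s y /\ length s = k) /\
              (forall s, runs U s y -> k <= length s)).
  { clear s Hs. induction n as [n IH] using lt_wf_ind. intros s Hl Hs.
    destruct (classic (exists s', length s' < n /\ runs U s' y)) as [(s' & L & R)|N].
    - exact (IH _ L s' eq_refl R).
    - exists n. split; [eauto|]. intros s' R.
      destruct (le_gt_dec n (length s')); [assumption|]. exfalso. eauto. }
  eauto.
Qed.

Lemma Kc_le_machine N :
  prefix_free_machine N -> exists c, forall s y, runs N s y -> Kc U y <= length s + c.
Proof.
  intros HN. destruct (proj2 HU N HN) as [c Hc]. exists c. intros s y R.
  destruct (Hc s y R) as (t & Ht & L).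
  pose proof (proj2 (Kc_spec y) t Ht). lia.
Qed.

(** Running [U] first gives a machine whose domain lies within that of [U] and is therefore
    prefix-free. *)
Lemma Kc_computable_image (f : nat -> nat) :
  comp f -> exists c, forall y, Kc U (f y) <= Kc U y + c.
Proof.
  intros Hf. destruct (computable_of_comp _ Hf) as [e He].
  assert (PF : prefix_free_machine (PComp e [U])).
  { assert (D : forall s, halts (PComp e [U]) s -> halts U s).
    { intros s [y R]. inversion R as [| | |f' gs xs ys z Hgs _| | |]; subst.
      inversion Hgs; subst. eexists; eassumption. }
    intros s t Hs Ht. apply (proj1 HU); auto. }
  destruct (Kc_le_machine _ PF) as [c Hc]. exists c. intros y.
  destruct (proj1 (Kc_spec y)) as (s & R & <-).
  apply Hc. eapply ev_comp; [ev_args; exact R|apply He].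
Qed.

End Complexity.

(** * Decoding of tuples *)

Definition list_of (y : nat) : list nat :=
  rev (snd (nrec (y, nil) (fun _ (s : nat * list nat) =>
    match fst s with 0 => s | S v => (pi2 v, pi1 v :: snd s) end) y)).

Lemma list_of_code_list l : list_of (code_list l) = l.
Proof.
  unfold list_of.
  set (g := fun s : nat * list nat =>
    match fst s with 0 => s | S v => (pi2 v, pi1 v :: snd s) end).
  assert (G : forall n l acc, length l <= n ->
    snd (nrec (code_list l, acc) (fun _ s => g s) n) = rev l ++ acc).
  { induction n as [|n IH]; intros m acc Hl.
    - destruct m; [reflexivity|simpl in Hl; lia].
    - rewrite nrec_succ_front. destruct m as [|a m].
      + change (g (code_list nil, acc)) with (code_list nil, acc).
        now rewrite IH by (simpl; lia).
      + change (g (code_list (a :: m), acc))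
          with (pi2 (pairN a (code_list m)), pi1 (pairN a (code_list m)) :: acc).
        rewrite pi1_pairN, pi2_pairN, IH by (simpl in Hl; lia).
        simpl. now rewrite <- app_assoc. }
  rewrite (G _ l nil), app_nil_r; [apply rev_involutive|].
  rewrite <- enc_code_list. apply length_le_enc.
Qed.

Lemma length_le_code_list l : length l <= code_list l.
Proof. rewrite <- enc_code_list. apply length_le_enc. Qed.

Lemma comp_list_of {X} `{Enc X} (f : X -> nat) : comp f -> comp (fun x => list_of (f x)).
Proof. intros Hf. unfold list_of. apply comp_rev. computes. Qed.

Lemma comp_code_list {X} `{Enc X} (f : X -> list nat) :
  comp f -> comp (fun x => code_list (f x)).
Proof.
  intros Hf. apply (comp_ext (fun x => enc (f x))); [intros x; apply enc_code_list|].
  now apply comp_enc.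
Qed.

(** * Levels and the stage construction *)

(* A level [s = <y, <u, t>>] is valid when the string coded by [u] describes [y] and halts with least fuel [t]: such an [s] is computable from the string and determines its length. *)
Definition valid (U : prf) (s : nat) : bool :=
  match run U (pi2 (pi2 s)) [pi1 (pi2 s)] with
  | None => false
  | Some y =>
      ((y =? pi1 s) &&
       match pi2 (pi2 s) with
       | 0 => true
       | S k => match run U k [pi1 (pi2 s)] with None => true | Some _ => false end
       end)%bool
  end.

Definition level_length (s : nat) : nat := blen (pi1 (pi2 s)).

(* Successor of the greatest valid level below [s]; 0 if there is none. *)
Definition prev (U : prf) (s : nat) : nat :=
  nrec 0 (fun k r => if valid U k then S k else r) s.

(* [u] codes [0^j 1 w] where [w] describes [<p, s + 5>]; the padding lets a node carry the excess of its length over [level_length s]. *)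
Definition attempt (U : prf) (u t : nat) : option (nat * nat) :=
  if snd (strip u) then
    match run U t [fst (strip u)] with
    | None => None
    | Some z =>
        if ((5 <=? pi2 z) &&
            (valid U (pi2 z - 5) && (level_length (pi2 z - 5) <=? blen u)))%bool
        then Some (pi1 z, pi2 z - 5) else None
    end
  else None.

(** In [(u, (B, tau))], the description coded by [u] serves [tau], and [B] is the excess of its
    length over that of the level. *)
Definition node : Type := (nat * (nat * list nat))%type.

(** If [s0] is the preceding valid level, [prev U s = s0 + 1] is the length of its tuples and
    [prev U s + 4 = s0 + 5] is the precision of the distance test. The first valid level starts from
    the empty tuple. *)
Definition parent (U : prf) (D : nat -> nat -> nat -> nat) (st : list node) (B p s : nat)
  : option (list nat) :=
  if prev U s =? 0 then Some nil else
  match find (fun e : node =>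
          ((fst (snd e) =? B) &&
           ((length (snd (snd e)) =? prev U s) &&
            (D p (last (snd (snd e)) 0%nat) (prev U s + 4) <=? 2)))%bool) st with
  | None => None
  | Some e => Some (snd (snd e))
  end.

(** The resulting length [s + 1] makes the level readable from the tuple. *)
Definition extend (tau : list nat) (p s : nat) : list nat :=
  tau ++ repeat p (S s - length tau).

(** A stage codes a description and a fuel, so a description is retried with every fuel until a
    parent appears. Once served, it is never served again. *)
Definition stage (U : prf) (D : nat -> nat -> nat -> nat) (t : nat) (st : list node)
  : list node :=
  match find (fun e : node => fst e =? pi1 t) st with
  | Some _ => st
  | None =>
      match attempt U (pi1 t) (pi2 t) with
      | None => st
      | Some ps =>
          match parent U D st (blen (pi1 t) - level_length (snd ps)) (fst ps) (snd ps) with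
          | None => st
          | Some tau =>
              (pi1 t, (blen (pi1 t) - level_length (snd ps),
                       extend tau (fst ps) (snd ps))) :: st
          end
      end
  end.

Definition state (U : prf) (D : nat -> nat -> nat -> nat) (T : nat) : list node :=
  nrec nil (stage U D) T.

Definition served U D (u B : nat) (tau : list nat) : Prop :=
  exists T, In (u, (B, tau)) (state U D T).

(** * Computability of the stages *)

Section Computability.
Variables (U : prf) (D : nat -> nat -> nat -> nat).
Hypothesis HD : comp (fun p : nat * (nat * nat) => D (fst p) (fst (snd p)) (snd (snd p))).

Lemma comp_D {X} `{Enc X} (f g h : X -> nat) :
  comp f -> comp g -> comp h -> comp (fun x => D (f x) (g x) (h x)).
Proof.
  intros Hf Hg Hh.
  apply (comp_compose (fun p : nat * (nat * nat) => D (fst p) (fst (snd p)) (snd (snd p)))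
                      (fun x => (f x, (g x, h x)))); computes.
Qed.

Lemma comp_valid {X} `{Enc X} (f : X -> nat) : comp f -> comp (fun x => valid U (f x)).
Proof. intros Hf. unfold valid. computes. Qed.

Lemma comp_level_length {X} `{Enc X} (f : X -> nat) :
  comp f -> comp (fun x => level_length (f x)).
Proof. intros Hf. unfold level_length. computes. Qed.

Lemma comp_prev {X} `{Enc X} (f : X -> nat) : comp f -> comp (fun x => prev U (f x)).
Proof. intros Hf. unfold prev. computes. apply comp_valid. computes. Qed.

Lemma comp_attempt {X} `{Enc X} (f g : X -> nat) :
  comp f -> comp g -> comp (fun x => attempt U (f x) (g x)).
Proof.
  intros Hf Hg. apply (comp_app2 (attempt U)); auto.
  unfold attempt. computes.
  - apply comp_valid. computes.
  - apply comp_level_length. computes.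
Qed.

Lemma comp_parent {X} `{Enc X} (st : X -> list node) (B p s : X -> nat) :
  comp st -> comp B -> comp p -> comp s ->
  comp (fun x => parent U D (st x) (B x) (p x) (s x)).
Proof.
  intros Hst HB Hp Hs.
  apply (comp_compose
    (fun q : list node * (nat * (nat * nat)) =>
       parent U D (fst q) (fst (snd q)) (fst (snd (snd q))) (snd (snd (snd q))))
    (fun x => (st x, (B x, (p x, s x))))); [|computes].
  unfold parent. computes; try (apply comp_prev; computes).
  apply comp_D; computes. apply comp_prev. computes.
Qed.

Lemma comp_state {X} `{Enc X} (f : X -> nat) : comp f -> comp (fun x => state U D (f x)).
Proof.
  intros Hf. unfold state. computes. unfold stage, extend. computes.
  - apply comp_attempt; computes.
  - apply comp_parent; computes. apply comp_level_length; computes.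
  - apply comp_level_length; computes.
Qed.

End Computability.

(** * Structure of the served tuples *)

Section Construction.
Variables (U : prf) (D : nat -> nat -> nat -> nat).

Lemma valid_spec s :
  valid U s = true <->
  run U (pi2 (pi2 s)) [pi1 (pi2 s)] = Some (pi1 s) /\
  (forall t, t < pi2 (pi2 s) -> run U t [pi1 (pi2 s)] = None).
Proof.
  unfold valid. split.
  - destruct (run U (pi2 (pi2 s)) [pi1 (pi2 s)]) as [y|] eqn:E; [|discriminate].
    intros H. apply Bool.andb_true_iff in H as [H1 H2].
    apply Nat.eqb_eq in H1 as ->. split; [reflexivity|].
    intros t Ht. destruct (pi2 (pi2 s)) as [|k]; [lia|].
    destruct (run U k [pi1 (pi2 s)]) eqn:Ek; [discriminate|].
    destruct (run U t [pi1 (pi2 s)]) eqn:Et; [|reflexivity].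
    apply (run_mono _ _ k) in Et; [congruence|lia].
  - intros [-> H]. rewrite Nat.eqb_refl. simpl.
    destruct (pi2 (pi2 s)) as [|k]; [reflexivity|]. now rewrite H by lia.
Qed.

(** The least halting fuel completes a description to a valid level. The bound [y <= s] makes the
    valid levels unbounded, and makes level [s] at least the length of the tuple coded by [y]. *)
Lemma valid_level_exists w y :
  runs U w y ->
  exists s, valid U s = true /\ pi1 s = y /\ level_length s = length w /\ y <= s.
Proof.
  intros R. apply run_complete in R as [t0 R].
  assert (M : exists t, run U t [code_bits w] = Some y /\
                 forall t', t' < t -> run U t' [code_bits w] = None).
  { revert R. induction t0 as [t IH] using lt_wf_ind. intros R.
    destruct (classic (exists t', t' < t /\ run U t' [code_bits w] = Some y))
      as [(t' & L & E)|N]; [exact (IH t' L E)|].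
    exists t. split; [exact R|]. intros t' L.
    destruct (run U t' [code_bits w]) eqn:E; [|reflexivity].
    exfalso. apply N. exists t'. split; [exact L|].
    rewrite E. apply (run_mono _ _ t) in E; [congruence|lia]. }
  destruct M as (t & H1 & H2).
  exists (pairN y (pairN (code_bits w) t)).
  rewrite valid_spec. unfold level_length.
  rewrite !pi2_pairN, !pi1_pairN, blen_code_bits. repeat split; auto.
  apply pairN_ge1.
Qed.

Lemma prev_spec s :
  prev U s <= s /\
  match prev U s with
  | 0 => forall k, k < s -> valid U k = false
  | S s0 => valid U s0 = true /\ forall k, s0 < k -> k < s -> valid U k = false
  end.
Proof.
  unfold prev. induction s as [|s [IH1 IH2]]; [simpl; split; [lia|intros; lia]|].
  cbn [nrec]. destruct (valid U s) eqn:E.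
  - split; [lia|]. split; [exact E|]. intros; lia.
  - set (r := nrec _ _ s) in *. split; [lia|].
    destruct r as [|s0].
    + intros k Hk. destruct (Nat.eq_dec k s) as [->|]; [exact E|]. apply IH2. lia.
    + destruct IH2 as [H1 H2]. split; [exact H1|]. intros k Hk Hk'.
      destruct (Nat.eq_dec k s) as [->|]; [exact E|]. apply H2; lia.
Qed.

Lemma attempt_spec u t p s :
  attempt U u t = Some (p, s) ->
  exists j w, u = code_bits (pad j w) /\ run U t [code_bits w] = Some (pairN p (s + 5)) /\
    valid U s = true /\ level_length s <= blen u.
Proof.
  unfold attempt. destruct (strip u) as [v b] eqn:Es. cbn [fst snd].
  destruct b; [|discriminate].
  destruct (run U t [v]) as [z|] eqn:E; [|discriminate].
  destruct (_ && _)%bool eqn:C; [|discriminate].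
  apply Bool.andb_true_iff in C as [C1 C].
  apply Bool.andb_true_iff in C as [C2 C3].
  apply Nat.leb_le in C1, C3. intros [= <- <-].
  destruct (code_bits_surj u) as [w' <-].
  apply strip_true in Es as (j & w & -> & ->).
  exists j, w. repeat split; auto.
  rewrite E. f_equal. rewrite <- (pairN_pi z) at 1. f_equal. lia.
Qed.

Lemma attempt_intro j w t p s :
  run U t [code_bits w] = Some (pairN p (s + 5)) -> valid U s = true ->
  level_length s <= length (pad j w) ->
  attempt U (code_bits (pad j w)) t = Some (p, s).
Proof.
  intros R V L. unfold attempt. rewrite strip_pad, blen_code_bits. cbn [fst snd].
  rewrite R, pi1_pairN, pi2_pairN.
  replace (s + 5 - 5) with s by lia. rewrite V.
  apply Nat.leb_le in L. rewrite L.
  replace (5 <=? s + 5) with true by (symmetry; apply Nat.leb_le; lia). reflexivity.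
Qed.

Lemma attempt_mono u t t' ps :
  t <= t' -> attempt U u t = Some ps -> attempt U u t' = Some ps.
Proof.
  intros L. destruct ps as [p s]. intros H.
  apply attempt_spec in H as (j & w & -> & R & V & H).
  apply attempt_intro; auto.
  - apply run_mono with t; auto.
  - now rewrite blen_code_bits in H.
Qed.

Lemma attempt_det u t t' ps ps' :
  attempt U u t = Some ps -> attempt U u t' = Some ps' -> ps = ps'.
Proof.
  intros H H'.
  apply (attempt_mono _ _ (max t t')) in H; [|lia].
  apply (attempt_mono _ _ (max t t')) in H'; [|lia]. congruence.
Qed.

Lemma stage_cases T :
  state U D (S T) = state U D T \/
  exists p s tau,
    (forall e, In e (state U D T) -> fst e <> pi1 T) /\
    attempt U (pi1 T) (pi2 T) = Some (p, s) /\
    parent U D (state U D T) (blen (pi1 T) - level_length s) p s = Some tau /\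
    state U D (S T) =
      (pi1 T, (blen (pi1 T) - level_length s, extend tau p s)) :: state U D T.
Proof.
  change (state U D (S T)) with (stage U D T (state U D T)).
  unfold stage. set (st := state U D T).
  destruct (find _ st) eqn:E; [now left|].
  destruct (attempt U (pi1 T) (pi2 T)) as [[p s]|]; [|now left].
  cbn [fst snd]. destruct (parent U D st _ p s) as [tau|] eqn:P; [|now left].
  right. exists p, s, tau. repeat split; auto.
  intros e He Eq. apply (find_none _ _ E) in He. cbv beta in He.
  apply Nat.eqb_neq in He. auto.
Qed.

Lemma state_mono T T' e : T <= T' -> In e (state U D T) -> In e (state U D T').
Proof.
  induction 1 as [|T' _ IH]; [auto|]. intros H. specialize (IH H).
  destruct (stage_cases T') as [->|(p & s & tau & _ & _ & _ & ->)]; [auto|now right].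
Qed.

Lemma state_unique T u e e' :
  In (u, e) (state U D T) -> In (u, e') (state U D T) -> e = e'.
Proof.
  induction T as [|T IH]; [intros []|].
  destruct (stage_cases T) as [->|(p & s & tau & N & _ & _ & ->)]; [auto|].
  intros [E|H] [E'|H'].
  - congruence.
  - injection E as <- _. exfalso. exact (N _ H' eq_refl).
  - injection E' as <- _. exfalso. exact (N _ H eq_refl).
  - auto.
Qed.

Lemma served_unique u B tau B' tau' :
  served U D u B tau -> served U D u B' tau' -> (B, tau) = (B', tau').
Proof.
  intros [T H] [T' H']. apply (state_unique (max T T') u).
  - apply state_mono with T; [lia|auto].
  - apply state_mono with T'; [lia|auto].
Qed.

Lemma served_inv u B tau :
  served U D u B tau ->
  exists p s t tau0,
    attempt U u t = Some (p, s) /\ B = blen u - level_length s /\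
    length tau0 = prev U s /\ tau = extend tau0 p s /\
    (prev U s <> 0 ->
     (exists u0, served U D u0 B tau0) /\ D p (last tau0 0) (prev U s + 4) <= 2).
Proof.
  intros [T H]. induction T as [|T IH]; [destruct H|].
  destruct (stage_cases T) as [E|(p & s & tau0 & _ & A & P & E)]; rewrite E in H; [auto|].
  destruct H as [H|H]; [|auto]. injection H as <- <- <-.
  exists p, s, (pi2 T), tau0.
  unfold parent in P. destruct (Nat.eqb_spec (prev U s) 0) as [Z|Z].
  - injection P as <-. repeat split; auto; contradiction.
  - destruct (find _ _) as [[u0 [B0 tau1]]|] eqn:F; [|discriminate].
    cbn [fst snd] in P. injection P as ->.
    apply find_some in F as [I C]. cbn [fst snd] in C.
    apply Bool.andb_true_iff in C as [C1 C].
    apply Bool.andb_true_iff in C as [C2 C3].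
    apply Nat.eqb_eq in C1, C2. apply Nat.leb_le in C3. subst B0.
    repeat split; auto. exists u0. now exists T.
Qed.

Lemma extend_length tau p s : length tau <= S s -> length (extend tau p s) = S s.
Proof. intros H. unfold extend. rewrite length_app, repeat_length. lia. Qed.

Lemma extend_last tau p s d : length tau <= s -> last (extend tau p s) d = p.
Proof.
  intros H. unfold extend. replace (S s - length tau) with (S (s - length tau)) by lia.
  cbn [repeat]. rewrite repeat_cons, app_assoc. apply last_last.
Qed.

Lemma served_shape u B tau :
  served U D u B tau ->
  exists p s t, attempt U u t = Some (p, s) /\ valid U s = true /\
    length tau = S s /\ last tau 0 = p /\ blen u = B + level_length s.
Proof.
  intros H. apply served_inv in H as (p & s & t & tau0 & A & -> & L & -> & _).
  destruct (attempt_spec _ _ _ _ A) as (j & w & _ & _ & V & Lu).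
  pose proof (prev_spec s) as [Pl _].
  exists p, s, t. repeat split; auto.
  - apply extend_length. lia.
  - rewrite <- L in Pl. now apply extend_last.
  - lia.
Qed.

(** The parent of a served tuple is served at the preceding valid level with the same [B], so the
    descent along parents meets every valid level below [s]. *)
Lemma served_ancestor B s' : valid U s' = true ->
  forall s u tau, served U D u B tau -> length tau = S s -> s' <= s ->
  exists u', served U D u' B (firstn (S s') tau).
Proof.
  intros V. induction s as [s IH] using lt_wf_ind. intros u tau H Hl Hs.
  destruct (Nat.eq_dec s' s) as [->|Hne].
  { exists u. rewrite <- Hl, firstn_all. exact H. }
  apply served_inv in H as (p & s1 & t & tau0 & A & _ & L & -> & P).
  pose proof (prev_spec s1) as [Pl Pm].
  rewrite extend_length in Hl by lia. injection Hl as ->.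
  destruct (prev U s) as [|s0] eqn:E.
  { rewrite Pm in V by lia. discriminate. }
  destruct P as [[u0 S0] _]; [discriminate|]. destruct Pm as [_ Pm].
  assert (s' <= s0).
  { destruct (le_gt_dec s' s0); [assumption|]. rewrite Pm in V by lia. discriminate. }
  unfold extend. rewrite firstn_app.
  replace (S s' - length tau0) with 0 by lia. rewrite firstn_O, app_nil_r.
  apply (IH s0 ltac:(lia) u0); auto.
Qed.

(** The description of such a tuple has length [B + level_length s], so its code is bounded, and
    each description serves at most one tuple. *)
Lemma served_level_finite B s :
  exists F : list (list nat),
    forall u tau, served U D u B tau -> length tau = S s -> In tau F.
Proof.
  assert (G : forall N, exists F, forall u tau, u < N -> served U D u B tau -> In tau F).
  { induction N as [|N [F HF]]; [exists nil; intros; lia|].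
    destruct (classic (exists tau, served U D N B tau)) as [[tau H]|H].
    - exists (tau :: F). intros u tau' L H'.
      destruct (Nat.eq_dec u N) as [->|]; [|right; apply (HF u); auto; lia].
      left. pose proof (served_unique _ _ _ _ _ H H'). congruence.
    - exists F. intros u tau' L H'.
      destruct (Nat.eq_dec u N) as [->|]; [exfalso; eauto|apply (HF u); auto; lia]. }
  destruct (G (2 ^ S (B + level_length s))) as [F HF].
  exists F. intros u tau H Hl. apply (HF u); auto.
  apply served_shape in H as (p & s1 & t & _ & _ & Hl' & _ & Hu).
  rewrite Hl in Hl'. injection Hl' as <-.
  destruct (code_bits_surj u) as [w <-]. rewrite blen_code_bits in Hu.
  pose proof (code_bits_ub w) as Hb. rewrite Hu in Hb. lia.
Qed.

(** * Correct tuples and Konig's lemma *)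

Section Paths.
(* [Q p s]: the point [p] is a correct choice at level [s]. *)
Variable Q : nat -> nat -> Prop.
Hypothesis Q_near : forall p0 s0 p s,
  Q p0 s0 -> Q p s -> s0 < s -> D p p0 (S s0 + 4) <= 2.
Variable B : nat.
Hypothesis Q_attempt : forall s, valid U s = true ->
  exists u t p, attempt U u t = Some (p, s) /\ blen u = B + level_length s /\ Q p s.
Hypothesis valid_unbounded : forall L, exists s, L <= s /\ valid U s = true.

Definition correct (s : nat) (tau : list nat) : Prop :=
  valid U s = true /\ (exists u, served U D u B tau) /\
  length tau = S s /\ Q (last tau 0) s.

(** Once a correct tuple is served at the preceding level, a parent is found at every later stage.
    That parent may be an incorrect tuple, but the new tuple ends in [p], and correctness concerns
    only the last entry. *)
Lemma correct_exists s : valid U s = true -> exists tau, correct s tau.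
Proof.
  induction s as [s IH] using lt_wf_ind. intros V.
  destruct (Q_attempt s V) as (u & t & p & A & Lu & Hp).
  destruct (prev_spec s) as [Pl Pm].
  assert (HP : exists T0, forall T, T0 <= T ->
            exists tau, parent U D (state U D T) B p s = Some tau).
  { unfold parent. destruct (prev U s) as [|s0] eqn:E.
    - exists 0. intros T _. now exists nil.
    - destruct Pm as [V0 _].
      destruct (IH s0 ltac:(lia) V0) as (tau0 & _ & [u0 [T0 I]] & L0 & Q0).
      exists T0. intros T HT. cbn [Nat.eqb].
      destruct (find _ (state U D T)) as [e|] eqn:F; [eauto|exfalso].
      apply (state_mono _ T) in I; [|exact HT].
      apply (find_none _ _ F) in I. cbn [fst snd] in I.
      rewrite L0, !Nat.eqb_refl in I.
      pose proof (Q_near _ _ _ _ Q0 Hp ltac:(lia)) as N. apply Nat.leb_le in N.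
      rewrite N in I. discriminate. }
  destruct HP as [T0 HP].
  (* This stage treats [u] with enough fuel, after a suitable parent has appeared. *)
  set (T := pairN u (max t T0)).
  assert (HT : max t T0 <= T) by apply pairN_ge2.
  assert (AT : attempt U (pi1 T) (pi2 T) = Some (p, s)).
  { unfold T. rewrite pi1_pairN, pi2_pairN. apply attempt_mono with t; [lia|exact A]. }
  assert (HB : blen (pi1 T) - level_length s = B)
    by (unfold T; rewrite pi1_pairN; lia).
  destruct (HP T ltac:(lia)) as [tau0 Htau0].
  assert (I : exists B' tau, In (u, (B', tau)) (state U D (S T))).
  (* If [u] was served earlier, its tuple does as well, since the attempt always yields the same [p]
     and [s]. *)
  { change (state U D (S T)) with (stage U D T (state U D T)). unfold stage.
    destruct (find _ (state U D T)) as [[u1 [B1 tau1]]|] eqn:F.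
    - apply find_some in F as [I E]. apply Nat.eqb_eq in E. cbn [fst] in E.
      unfold T in E. rewrite pi1_pairN in E. subst u1. eauto.
    - rewrite AT. cbn [fst snd]. rewrite HB, Htau0.
      unfold T. rewrite pi1_pairN. do 2 eexists. left. reflexivity. }
  destruct I as (B' & tau & I).
  assert (Sv : served U D u B' tau) by (now exists (S T)).
  destruct (served_shape _ _ _ Sv) as (p1 & s1 & t1 & A1 & _ & L1 & La & Lu1).
  pose proof (attempt_det _ _ _ _ _ A A1) as [= <- <-].
  replace B' with B in * by lia.
  exists tau. repeat split; eauto. now rewrite La.
Qed.

Lemma infinite_pigeonhole {A} (F : list A) (P : nat -> A -> Prop) :
  (forall L, exists n a, L <= n /\ In a F /\ P n a) ->
  exists a, In a F /\ forall L, exists n, L <= n /\ P n a.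
Proof.
  induction F as [|a F IH]; intros H.
  - destruct (H 0) as (n & a & _ & [] & _).
  - destruct (classic (forall L, exists n, L <= n /\ P n a)) as [Ha|Ha].
    + exists a. split; [now left|exact Ha].
    + apply not_all_ex_not in Ha as [L0 H0].
      destruct IH as (a' & I & H').
      * intros L. destruct (H (max L L0)) as (n & a' & Hn & [<-|I] & HP).
        -- exfalso. apply H0. exists n. split; [lia|exact HP].
        -- exists n, a'. repeat split; auto. lia.
      * exists a'. split; [now right|exact H'].
Qed.

(** A prefix of a correct tuple is served at each lower valid level but may end in an incorrect
    point, so correctness is asked of the extensions only. *)
Definition infinitely_extended (l : list nat) : Prop :=
  forall L, exists s, L <= s /\ exists tau, correct s tau /\ firstn (length l) tau = l.

Lemma firstn_snoc (tau : list nat) n :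
  n < length tau -> firstn (S n) tau = firstn n tau ++ [nth n tau 0].
Proof.
  revert tau. induction n as [|n IH]; intros [|a tau] H; simpl in *; try lia; [reflexivity|].
  f_equal. apply IH. lia.
Qed.

Lemma nth_firstn_lt (tau : list nat) n i : i < n -> nth i (firstn n tau) 0 = nth i tau 0.
Proof.
  revert tau i. induction n as [|n IH]; intros [|a tau] [|i] H; simpl; try lia; auto.
  apply IH. lia.
Qed.

(** At a valid level [s0 >= length l] only finitely many tuples are served. One of them, [r], is a
    prefix of correct tuples of unbounded level that extend [l]; its entry at position [length l] is
    the next value. *)
Lemma infinitely_extended_step l :
  infinitely_extended l -> exists a, infinitely_extended (l ++ [a]).
Proof.
  intros H. destruct (valid_unbounded (length l)) as (s0 & L0 & V0).
  destruct (served_level_finite B s0) as [F HF].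
  destruct (infinite_pigeonhole F (fun s r => exists tau, correct s tau /\
              firstn (length l) tau = l /\ firstn (S s0) tau = r)) as (r & _ & Hr).
  - intros L. destruct (H (max L s0)) as (s & Ls & tau & C & E).
    exists s, (firstn (S s0) tau). split; [lia|]. split; [|eauto].
    destruct C as (_ & [u Hu] & Hl & _).
    destruct (served_ancestor B s0 V0 s u tau Hu Hl ltac:(lia)) as [u' Hu'].
    apply (HF u' _ Hu'). rewrite length_firstn. lia.
  - exists (nth (length l) r 0). intros L.
    destruct (Hr (max L s0)) as (s & Ls & tau & C & E & E').
    exists s. split; [lia|]. exists tau. split; [exact C|].
    destruct C as (_ & _ & Hl & _).
    rewrite length_app, Nat.add_1_r, firstn_snoc by lia.
    rewrite E, <- E', nth_firstn_lt by lia. reflexivity.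
Qed.

Lemma correct_path :
  exists alpha : nat -> nat, forall n L, exists s, L <= s /\
    exists tau, correct s tau /\ firstn n tau = map alpha (seq 0 n).
Proof.
  set (next := fun l => epsilon (inhabits 0) (fun a => infinitely_extended (l ++ [a]))).
  set (pre := nrec (@nil nat) (fun _ l => l ++ [next l])).
  assert (Hpre : forall n, infinitely_extended (pre n) /\ length (pre n) = n).
  { induction n as [|n [IH1 IH2]].
    - split; [|reflexivity]. intros L. destruct (valid_unbounded L) as (s & Ls & V).
      destruct (correct_exists s V) as [tau C]. eauto.
    - change (pre (S n)) with (pre n ++ [next (pre n)]). split.
      + unfold next. apply epsilon_spec. now apply infinitely_extended_step.
      + rewrite length_app, IH2. simpl. lia. }
  exists (fun n => next (pre n)). intros n L.
  assert (E : map (fun n => next (pre n)) (seq 0 n) = pre n).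
  { induction n as [|n IH]; [reflexivity|].
    rewrite seq_S, map_app, IH. reflexivity. }
  rewrite E. destruct (Hpre n) as [H Hl].
  unfold infinitely_extended in H. rewrite Hl in H. exact (H L).
Qed.

End Paths.

End Construction.

(** * Complexity bounds for levels and served tuples *)

Section Machines.
Variables (U : prf) (HU : optimal_pf_machine U).

(** The machine turns a description [w] of [y] into [<y, <w, t>> + 5], where [t] is the least
    halting fuel. Validity of [s] says that its last component is this [t]. *)
Lemma Kc_level :
  exists c, forall s, valid U s = true -> Kc U (s + 5) <= level_length s + c.
Proof.
  destruct (mu_machine
    (fun p => match run U (fst p) [snd p] with None => false | Some _ => true end)
    (fun p => match run U (fst p) [snd p] with
              | None => 0 | Some y => pairN y (pairN (snd p) (fst p)) + 5 end)) as [e He].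
  - computes.
  - computes.
  - assert (PF : prefix_free_machine e).
    { assert (Hh : forall s, halts e s -> halts U s).
      { intros s [z R]. apply He in R as (t & E & _ & _). cbn [fst snd] in E.
        destruct (run U t [code_bits s]) as [y|] eqn:Er; [|discriminate].
        exists y. exact (run_sound _ _ _ _ Er). }
      intros s t Hs Ht. apply (proj1 HU); auto. }
    destruct (Kc_le_machine U HU e PF) as [c Hc]. exists c. intros s V.
    apply valid_spec in V as [V1 V2]. unfold level_length.
    destruct (code_bits_surj (pi1 (pi2 s))) as [w Hw].
    rewrite <- Hw, blen_code_bits. apply Hc, He. rewrite Hw.
    exists (pi2 (pi2 s)). cbn [fst snd]. rewrite V1. repeat split.
    + intros t' Ht'. now rewrite V2.
    + now rewrite !pairN_pi.
Qed.

(** The machine waits until its input is served. The length of the tuple gives [s], and [pi1 s]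
    decodes to a tuple whose length is the number of entries to output. *)
Lemma Kc_served (D : nat -> nat -> nat -> nat) :
  comp (fun p : nat * (nat * nat) => D (fst p) (fst (snd p)) (snd (snd p))) ->
  exists c, forall u B s tau, served U D u B tau -> length tau = S s ->
    Kc U (code_list (firstn (length (list_of (pi1 s))) tau)) <= B + level_length s + c.
Proof.
  intros HD.
  set (look := fun p : nat * nat =>
    find (fun e : node => fst e =? snd p) (state U D (fst p))).
  set (G := fun p => match look p with None => false | Some _ => true end).
  set (H := fun p => match look p with
    | None => 0
    | Some e => code_list (firstn
        (length (list_of (pi1 (length (snd (snd e)) - 1)))) (snd (snd e)))
    end).
  assert (Hlook : comp look) by (unfold look; computes; apply comp_state; computes).
  destruct (mu_machine G H) as [e He].
  - unfold G. computes.
  - unfold H. computes. apply comp_code_list. computes. apply comp_list_of. computes.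
  - assert (PF : prefix_free_machine e).
    (* Halting inputs are padded descriptions for [U], whence prefix-freeness. *)
    { assert (Hh : forall s, halts e s -> exists j w, s = pad j w /\ halts U w).
      { intros s [z R]. apply He in R as (T & E & _ & _). unfold G, look in E. cbn [fst snd] in E.
        destruct (find _ _) as [[u [B tau]]|] eqn:F; [|discriminate].
        apply find_some in F as [I Eu]. cbn [fst] in Eu. apply Nat.eqb_eq in Eu. subst u.
        assert (Sv : served U D (code_bits s) B tau) by (now exists T).
        apply served_shape in Sv as (p & s1 & t & A & _).
        apply attempt_spec in A as (j & w & Ew & R & _).
        apply code_bits_inj in Ew. exists j, w. split; [exact Ew|].
        eexists. exact (run_sound _ _ _ _ R). }
      intros s t Hs Ht P.
      apply Hh in Hs as (j & w & -> & Hw). apply Hh in Ht as (j' & w' & -> & Hw').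
      apply pad_prefix in P as [-> P]. now rewrite (proj1 HU w w' Hw Hw' P). }
    destruct (Kc_le_machine U HU e PF) as [c Hc]. exists c.
    intros u B s tau Sv Hl.
    pose proof (served_shape U D _ _ _ Sv) as (p & s1 & t & _ & _ & Hl' & _ & Lu).
    rewrite Hl in Hl'. injection Hl' as <-.
    destruct (code_bits_surj u) as [w <-]. rewrite blen_code_bits in Lu. rewrite <- Lu.
    apply Hc. unfold runs.
    destruct Sv as [T I].
    destruct (mu_machine_total G H _ He (code_bits w) T) as (T0 & _ & G0 & E0).
    { unfold G, look. cbn [fst snd].
      destruct (find _ _) eqn:F; [reflexivity|].
      apply (find_none _ _ F) in I. cbn [fst] in I. now rewrite Nat.eqb_refl in I. }
    unfold G, H, look in G0, E0. cbn [fst snd] in G0, E0.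
    destruct (find _ _) as [[u1 [B1 tau1]]|] eqn:F; [|discriminate].
    apply find_some in F as [I1 Eu]. cbn [fst] in Eu. apply Nat.eqb_eq in Eu. subst u1.
    (* The search may stop at a stage other than [T], but a description serves only one tuple. *)
    assert (Eq : (B1, tau1) = (B, tau)) by
      (apply (served_unique U D (code_bits w)); eexists; eassumption).
    injection Eq as -> ->. cbn [snd] in E0. rewrite Hl in E0.
    replace (S s - 1) with s in E0 by lia. exact E0.
Qed.

End Machines.

(** * Metric estimates *)

(** [epsilon] picks a value that [e] itself outputs, so the chosen [D] is computed by [e]. *)
Lemma dist_approximation (M : CMS) :
  exists D : nat -> nat -> nat -> nat,
    comp (fun p : nat * (nat * nat) => D (fst p) (fst (snd p)) (snd (snd p))) /\
    forall i k n,
      (Rabs (dist M (special M i) (special M k) - INR (D i k n) / 2 ^ n) <= / 2 ^ n)%R.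
Proof.
  destruct (dist_computable M) as [e He].
  set (D := fun i k n => epsilon (inhabits 0) (fun m => eval e [i; k; n] m /\
      (Rabs (dist M (special M i) (special M k) - INR m / 2 ^ n) <= / 2 ^ n)%R)).
  assert (HD : forall i k n, eval e [i; k; n] (D i k n) /\
      (Rabs (dist M (special M i) (special M k) - INR (D i k n) / 2 ^ n) <= / 2 ^ n)%R).
  { intros i k n. apply epsilon_spec, He. }
  exists D. split; [|intros; apply HD].
  exists (fun z => D (pi1 z) (pi1 (pi2 z)) (pi2 (pi2 z))). split.
  - destruct (computable_pi1 _ computable_id) as [e1 H1].
    destruct (computable_pi1 _ (computable_pi2 _ computable_id)) as [e2 H2].
    destruct (computable_pi2 _ (computable_pi2 _ computable_id)) as [e3 H3].
    exists (PComp e [e1; e2; e3]). intros z.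
    eapply ev_comp; [ev_args; [apply H1|apply H2|apply H3]|apply HD].
  - intros [i [k n]]. change (enc (i, (k, n))) with (pairN i (pairN k n)).
    now rewrite !pi2_pairN, !pi1_pairN.
Qed.

Local Open Scope R_scope.

Lemma inv_pow2_pos n : 0 < / 2 ^ n.
Proof. apply Rinv_0_lt_compat, pow_lt. lra. Qed.

Lemma inv_pow2_add n k : / 2 ^ (n + k) = / 2 ^ n * / 2 ^ k.
Proof. rewrite pow_add. apply Rinv_mult. Qed.

Lemma inv_pow2_le i k : (i <= k)%nat -> / 2 ^ k <= / 2 ^ i.
Proof.
  intros H. apply Rinv_le_contravar; [apply pow_lt; lra|]. apply Rle_pow; [lra|exact H].
Qed.

Lemma inv_pow2_lt i k : (i < k)%nat -> 2 * / 2 ^ k <= / 2 ^ i.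
Proof.
  intros H. pose proof (inv_pow2_le (i + 1) k ltac:(lia)) as L.
  rewrite inv_pow2_add in L. lra.
Qed.

Lemma inv_pow2_small eps : 0 < eps -> exists N, forall n, (N <= n)%nat -> / 2 ^ n < eps.
Proof.
  intros He. destruct (pow_lt_1_zero (/ 2)) with (y := eps) as [N HN]; auto.
  - rewrite Rabs_right; lra.
  - exists N. intros n Hn. specialize (HN n Hn). rewrite pow_inv in HN.
    rewrite Rabs_right in HN; [exact HN|]. apply Rle_ge, Rlt_le, inv_pow2_pos.
Qed.

Section Metric.
Variables (U : prf) (M : CMS) (D : nat -> nat -> nat -> nat).
Hypothesis HD : forall i k n,
  Rabs (dist M (special M i) (special M k) - INR (D i k n) / 2 ^ n) <= / 2 ^ n.

(** With unit [2^-n] and error at most one unit, the test [D <= 2] bounds the distance by 3 units;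
    conversely, by the next lemma, every distance below 2 units passes it. *)
Lemma D_le_2_dist i k n : (D i k n <= 2)%nat -> dist M (special M i) (special M k) <= 3 * / 2 ^ n.
Proof.
  intros H. apply le_INR in H. simpl in H.
  pose proof (HD i k n) as A. pose proof (inv_pow2_pos n) as P.
  pose proof (Rle_abs (dist M (special M i) (special M k) - INR (D i k n) / 2 ^ n)) as A'.
  pose proof (Rmult_le_compat_r _ _ _ (Rlt_le _ _ P) H).
  unfold Rdiv in *. lra.
Qed.

Lemma dist_D_le_2 i k n : dist M (special M i) (special M k) < 2 * / 2 ^ n -> (D i k n <= 2)%nat.
Proof.
  intros H. pose proof (HD i k n) as A. pose proof (inv_pow2_pos n) as P.
  pose proof (Rle_abs (- (dist M (special M i) (special M k) - INR (D i k n) / 2 ^ n))) as A'.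
  rewrite Rabs_Ropp in A'.
  assert (L : INR (D i k n) < INR 3) by (apply (Rmult_lt_reg_r (/ 2 ^ n)); [exact P|]; unfold Rdiv in *; simpl; lra).
  apply INR_lt in L. lia.
Qed.

(** A step from level [s0] to [s] moves the last point by at most [3 * 2^-(s0+5)]. As [s0 < s], this
    is at most [6 * (2^-(s0+5) - 2^-(s+5))], and these differences telescope. *)
Lemma served_dist B : forall s u tau,
  served U D u B tau -> length tau = S s -> forall i, (i <= s)%nat ->
  dist M (special M (nth i tau 0%nat)) (special M (last tau 0%nat))
    <= 6 * (/ 2 ^ (i + 5) - / 2 ^ (s + 5)).
Proof.
  induction s as [s IH] using lt_wf_ind. intros u tau H Hl i Hi.
  apply served_inv in H as (p & s1 & t & tau0 & A & _ & L & -> & P).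
  pose proof (prev_spec U s1) as [Pl Pm].
  rewrite extend_length in Hl by lia. injection Hl as ->.
  rewrite extend_last by lia. unfold extend.
  destruct (le_lt_dec (length tau0) i) as [Hlt|Hlt].
  - rewrite app_nth2, nth_repeat_lt by lia.
    rewrite (proj2 (dist_eq0 M _ _) eq_refl).
    pose proof (inv_pow2_le (i + 5) (s + 5) ltac:(lia)). lra.
  - rewrite app_nth1 by lia.
    destruct (prev U s) as [|s0]; [lia|].
    destruct P as [[u0 S0] P]; [discriminate|].
    specialize (IH s0 ltac:(lia) u0 tau0 S0 L i ltac:(lia)).
    apply D_le_2_dist in P. rewrite (dist_sym M) in P.
    replace (S s0 + 4)%nat with (s0 + 5)%nat in P by lia.
    pose proof (inv_pow2_lt (s0 + 5) (s + 5) ltac:(lia)).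
    pose proof (dist_tri M (special M (nth i tau0 0%nat)) (special M (last tau0 0%nat))
                  (special M p)). lra.
Qed.

End Metric.

(** * Cauchy names and the two implications *)

Lemma cauchy_name_dist (M : CMS) alpha (x : M) s :
  cauchy_name M alpha x -> dist M (special M (alpha s)) x <= / 2 ^ s.
Proof.
  intros [H1 H2]. apply le_epsilon. intros eps He.
  destruct (H2 eps He) as [N HN].
  specialize (HN (max s N) ltac:(lia)). specialize (H1 s (max s N) ltac:(lia)).
  pose proof (dist_tri M (special M (alpha s)) (special M (alpha (max s N))) x). lra.
Qed.

(** The errors [2^-(s+1)] and [2^-(t+1)] add up to at most [2^-s]. *)
Lemma cauchy_name_of_dist (M : CMS) (alpha : nat -> nat) (x : M) :
  (forall i, dist M (special M (alpha i)) x <= / 2 ^ (i + 1)) -> cauchy_name M alpha x.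
Proof.
  intros H. split.
  - intros s t L. pose proof (H s) as Hs. pose proof (H t) as Ht.
    pose proof (inv_pow2_le (s + 1) (t + 1) ltac:(lia)).
    pose proof (dist_tri M (special M (alpha s)) x (special M (alpha t))) as T.
    rewrite (dist_sym M x) in T. rewrite (inv_pow2_add s 1) in *. lra.
  - intros eps He. destruct (inv_pow2_small eps He) as [N HN].
    exists N. intros s Hs. specialize (HN (s + 1)%nat ltac:(lia)). specialize (H s). lra.
Qed.

Lemma K_trivial_name_locally_K_trivial (U : prf) (HU : optimal_pf_machine U) (M : CMS)
    (x : M) alpha b :
  cauchy_name M alpha x -> K_trivial_via U alpha b ->
  exists b', locally_K_trivial_via U M x b'.
Proof.
  intros Hc HK.
  (* This function takes the code of the first [n + 2] values of [alpha] to [<alpha (n + 1), n>]. *)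
  destruct (Kc_computable_image U HU (fun y =>
    pairN (last (list_of y) 0%nat) (length (list_of y) - 2))) as [c1 H1].
  { computes; apply comp_list_of; computes. }
  destruct (Kc_computable_image U HU (fun n => code_list (repeat 0%nat (n + 2)))) as [c2 H2].
  { apply comp_code_list. computes. }
  exists (c1 + b + c2)%nat. intros n. exists (alpha (n + 1)%nat). split.
  (* A name gives only a weak inequality; the index [n + 1] makes it strict at [2^-n]. *)
  - pose proof (cauchy_name_dist M alpha x (n + 1) Hc) as Hd.
    rewrite (dist_sym M), inv_pow2_add in Hd. pose proof (inv_pow2_pos n). simpl in Hd. lra.
  - specialize (H1 (code_list (map alpha (seq 0 (n + 2))))). specialize (H2 n).
    specialize (HK (n + 2)%nat). rewrite list_of_code_list in H1.
    rewrite length_map, length_seq in H1.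
    replace (n + 2)%nat with (S (n + 1)) in H1 at 1 by lia.
    rewrite seq_S, map_app in H1. cbn [map Nat.add] in H1. rewrite last_last in H1.
    replace (n + 2 - 2)%nat with n in H1 by lia. lia.
Qed.

Lemma locally_K_trivial_K_trivial_name (U : prf) (HU : optimal_pf_machine U) (M : CMS) :
  exists c : nat, forall (x : M) (b : nat),
    locally_K_trivial_via U M x b ->
    exists alpha, cauchy_name M alpha x /\ K_trivial_via U alpha (b + c).
Proof.
  destruct (dist_approximation M) as (D & CD & HD).
  destruct (Kc_level U HU) as [c1 H1].
  destruct (Kc_served U HU D CD) as [c2 H2].
  exists (c1 + 1 + c2)%nat. intros x b Hx.
  set (Q := fun p s => dist M x (special M p) < / 2 ^ (s + 5)).
  (* A shortest description of [<p, s + 5>] has length at most [level_length s + c1 + b]; the 1 pays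
     for the digit that ends the padding block. *)
  set (B := (c1 + b + 1)%nat).
  destruct (correct_path U D Q) with (B := B) as [alpha Ha].
  (* Both points lie within [2^-(s0+5)] of [x], hence less than two units apart. *)
  - intros p0 s0 p s Q0 Qp L. apply (dist_D_le_2 M D HD). unfold Q in *.
    pose proof (dist_tri M (special M p) x (special M p0)) as T.
    rewrite (dist_sym M (special M p) x) in T.
    replace (S s0 + 4)%nat with (s0 + 5)%nat by lia.
    pose proof (inv_pow2_le (s0 + 5) (s + 5) ltac:(lia)). lra.
  - intros s V. destruct (Hx (s + 5)%nat) as (p & Hp & Kp).
    destruct (proj1 (Kc_spec U HU (pairN p (s + 5)))) as (w & R & Lw).
    specialize (H1 s V). pose proof (run_complete _ _ _ R) as [t Ht].
    (* Solves [1 + j + length w = B + level_length s]; the choice of [B] makes the subtraction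
       exact. *)
    set (j := (level_length s + B - 1 - length w)%nat).
    assert (Lj : length (pad j w) = (B + level_length s)%nat)
      by (rewrite pad_length; unfold j, B; lia).
    exists (code_bits (pad j w)), t, p. repeat split.
    + apply attempt_intro; auto. lia.
    + now rewrite blen_code_bits.
    + exact Hp.
  - intros L. destruct (every_number_described U HU L) as [w R].
    destruct (valid_level_exists U w L R) as (s & V & _ & _ & Ls). eauto.
  - exists alpha. split.
    + apply cauchy_name_of_dist. intros i.
      (* A correct tuple of level [s >= i] that agrees with [alpha] up to [i]. The distance to its
         last point and from there to [x] sum to less than [6 * 2^-(i+5)], which is below
         [2^-(i+1)]. *)
      destruct (Ha (S i) i) as (s & Ls & tau & (_ & [u Hu] & Hl & Hq) & E).
      assert (Ei : nth i tau 0%nat = alpha i).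
      { rewrite <- (nth_firstn_lt tau (S i)) by lia.
        rewrite E, seq_S, map_app, app_nth2; rewrite length_map, length_seq; [|lia].
        now rewrite Nat.sub_diag. }
      pose proof (served_dist U M D HD B s u tau Hu Hl i Ls) as Hd. rewrite Ei in Hd.
      unfold Q in Hq. rewrite (dist_sym M) in Hq.
      pose proof (dist_tri M (special M (alpha i)) (special M (last tau 0%nat)) x).
      pose proof (inv_pow2_pos i). pose proof (inv_pow2_pos (s + 5)).
      rewrite (inv_pow2_add i 5) in Hd. rewrite (inv_pow2_add i 1). simpl in *. lra.
    + intros n.
      (* A shortest description [w] of [0^n] gives a level whose length is exactly [K(0^n)]. The
         initial segment of [alpha] of length [s + 1] is served there, being a prefix of a correct
         tuple of higher level. *)
      destruct (proj1 (Kc_spec U HU (code_list (repeat 0%nat n)))) as (w & R & Lw).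
      destruct (valid_level_exists U w _ R) as (s & V & Es & Lv & Ls).
      destruct (Ha (S s) s) as (s' & Ls' & tau & (_ & [u Hu] & Hl & _) & E).
      destruct (served_ancestor U D B s V s' u tau Hu Hl Ls') as [u' Hu'].
      rewrite E in Hu'.
      specialize (H2 u' B s _ Hu').
      rewrite length_map, length_seq, Es, list_of_code_list, repeat_length, Lv, Lw in H2.
      specialize (H2 eq_refl).
      (* The code of [0^n] is at least [n], so [n <= s] and the first [n] entries of the served
         tuple are those of [alpha]. *)
      pose proof (length_le_code_list (repeat 0%nat n)) as Ln. rewrite repeat_length in Ln.
      replace (S s) with (n + (S s - n))%nat in H2 by lia.
      rewrite seq_app, map_app, firstn_app, length_map, length_seq, Nat.sub_diag,
        firstn_all2, app_nil_r in H2 by (rewrite length_map, length_seq; lia).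
      unfold B in H2. lia.
Qed.

Theorem mainTheorem18 (U : prf) (HU : optimal_pf_machine U) (M : CMS) :
  (forall x : M,
     (exists alpha b, cauchy_name M alpha x /\ K_trivial_via U alpha b) <->
     (exists b, locally_K_trivial_via U M x b)) /\
  (exists c : nat, forall (x : M) (b : nat),
     locally_K_trivial_via U M x b ->
     exists alpha, cauchy_name M alpha x /\ K_trivial_via U alpha (b + c)).
Proof.
  pose proof (locally_K_trivial_K_trivial_name U HU M) as [c Hc].
  split; [|now exists c]. intros x. split.
  - intros (alpha & b & Ha & Hb). now apply (K_trivial_name_locally_K_trivial U HU M x alpha b).
  - intros [b Hb]. destruct (Hc x b Hb) as (alpha & Ha & Ht). eauto.
Qed.
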